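(* Let $\mathcal{M}$ be a von Neumann algebra with $\dim\mathcal{M}>1$, let $\mathcal{I}$ be a weak-operator dense ideal in $\mathcal{M}$, and let $\Phi$ be a unitarily invariant $\|\cdot\|$-dominating norm on $\mathcal{I}$. Let $\mathcal{P}(\mathcal{M})$ denote the set of projections in $\mathcal{M}$. Then the following statements are equivalent. (1) $\displaystyle \sup_{0\neq P\in\mathcal{P}(\mathcal{M})}\ \inf_{\substack{0\neq E\leqslant P\\ E\in\mathcal{I}\cap\mathcal{P}(\mathcal{M})}}\Phi(E)<\infty$. (2) For every $T\in\mathcal{M}$ and every $\varepsilon>0$, there exists an operator $X\in\mathcal{I}$ with $\Phi(X)<\varepsilon$ such that the spectrum of $T+X$ is disconnected.
   Context: A von Neumann algebra is a self-adjoint unital subalgebra of $\mathcal{B}(\mathcal{H})$ ($\mathcal{H}$ a complex Hilbert space, not necessarily separable) closed in the weak-operator topology. Ideals are two-sided and are not assumed to be norm closed. A projection is a self-adjoint idempotent. A norm $\Phi$ on an ideal $\mathcal{I}$ of $\mathcal{M}$ is called unitarily invariant if $\Phi(UXV)=\Phi(X)$ for all $X\in\mathcal{I}$ and all unitaries $U,V\in\mathcal{M}$; it is called $\|\cdot\|$-dominating if $\Phi(X)\geqslant\|X\|$ for all $X\in\mathcal{I}$, where $\|\cdot\|$ is the operator norm. *)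

(* Defs.v *)
From mathcomp Require Import all_boot all_order all_algebra.
From mathcomp Require Import sesquilinear complex.
From mathcomp Require Import all_classical all_reals all_analysis.

Set Implicit Arguments.
Unset Strict Implicit.
Unset Printing Implicit Defensive.

Import Order.TTheory GRing.Theory Num.Theory.
Import numFieldNormedType.Exports.

Local Open Scope classical_set_scope.
Local Open Scope complex_scope.
Local Open Scope ring_scope.

(* The inner product is linear in its first argument. *)
Record hilbertSpace (R : realType) := HilbertSpace {
  carrier :> completeNormedModType R[i] ;
  inner : {dot carrier for (@Num.conj R[i])} ;
  inner_normE : forall x : carrier, `|x| ^+ 2 = inner x x }.

(* Norms in a normed module over R[i] are elements of R[i] (with zero imaginary
   part); rnorm takes the value in R.  *)
Definition rnorm (R : realType) (V : normedZmodType R[i]) (x : V) : R :=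
  complex.Re `|x|.

(* Operators are bare functions H -> H, with the pointwise vector space
   structure; products are compositions. *)
Definition bounded_op (R : realType) (H : hilbertSpace R) (T : H -> H) : Prop :=
  linear T /\ exists c : R, forall x : H, rnorm (T x) <= c * rnorm x.

Definition opnorm (R : realType) (H : hilbertSpace R) (T : H -> H) : R :=
  sup [set rnorm (T x) | x in [set x : H | rnorm x <= 1]].

Definition adjoint_of (R : realType) (H : hilbertSpace R) (T S : H -> H) : Prop :=
  forall x y : H, inner H (T x) y = inner H x (S y).

(* R[i]^o is R[i] with its topology as a normed field. *)
Definition matrix_coef (R : realType) (H : hilbertSpace R) (T : H -> H) :
  {ptws (H * H)%type -> R[i]^o} := fun p => inner H (T p.1) p.2.

(* The weak-operator topology on all functions H -> H. It is only used on sets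
   of bounded operators, where it induces the usual one. *)
Definition wot_closure (R : realType) (H : hilbertSpace R) (A : set (H -> H)) :
  set (H -> H) := @closure (initial_topology (@matrix_coef R H)) A.

Definition operators (R : realType) (H : hilbertSpace R) : set (H -> H) :=
  [set T | bounded_op T].

Record von_neumann_algebra (R : realType) (H : hilbertSpace R)
    (M : set (H -> H)) : Prop := VonNeumannAlgebra {
  vna_bounded : M `<=` @operators R H ;
  vna_one : M idfun ;
  vna_add : forall S T, M S -> M T -> M (S + T) ;
  vna_scale : forall (a : R[i]) T, M T -> M (a *: T) ;
  vna_mul : forall S T, M S -> M T -> M (S \o T) ;
  vna_adjoint : forall T, M T -> exists2 S, M S & adjoint_of T S ;
  vna_closed : @operators R H `&` wot_closure M `<=` M }.

(* Linear dimension over the complex numbers. *)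
Definition dim_gt1 (R : realType) (H : hilbertSpace R) (M : set (H -> H)) : Prop :=
  exists S T, [/\ M S, M T &
    forall a b : R[i], a *: S + b *: T = 0 -> a = 0 /\ b = 0].

Record ideal (R : realType) (H : hilbertSpace R) (M I : set (H -> H)) : Prop :=
  Ideal {
  ideal_sub : I `<=` M ;
  ideal_zero : I 0 ;
  ideal_add : forall X Y, I X -> I Y -> I (X + Y) ;
  ideal_scale : forall (a : R[i]) X, I X -> I (a *: X) ;
  ideal_mull : forall T X, M T -> I X -> I (T \o X) ;
  ideal_mulr : forall X T, I X -> M T -> I (X \o T) }.

Definition wot_dense (R : realType) (H : hilbertSpace R)
  (M I : set (H -> H)) : Prop := M `<=` wot_closure I.

Definition unitary (R : realType) (H : hilbertSpace R) (U : H -> H) : Prop :=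
  exists V, [/\ adjoint_of U V, V \o U = idfun & U \o V = idfun].

Definition projection (R : realType) (H : hilbertSpace R) (P : H -> H) : Prop :=
  adjoint_of P P /\ P \o P = P.

(* In R[i], 0 <= z says that z is real and nonnegative. *)
Definition op_le (R : realType) (H : hilbertSpace R) (S T : H -> H) : Prop :=
  forall x : H, 0 <= inner H ((T - S) x) x.

Definition projections (R : realType) (H : hilbertSpace R)
  (M : set (H -> H)) : set (H -> H) := [set P | M P /\ projection P].

(* Only the values of Phi on I are relevant. *)
Record norm_on (R : realType) (H : hilbertSpace R) (I : set (H -> H))
    (Phi : (H -> H) -> R) : Prop := NormOn {
  norm_on_ge0 : forall X, I X -> 0 <= Phi X ;
  norm_on_eq0 : forall X, I X -> Phi X = 0 -> X = 0 ;
  norm_on_scale : forall (a : R[i]) X, I X -> Phi (a *: X) = rnorm a * Phi X ;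
  norm_on_triangle : forall X Y, I X -> I Y -> Phi (X + Y) <= Phi X + Phi Y }.

Definition unitarily_invariant (R : realType) (H : hilbertSpace R)
    (M I : set (H -> H)) (Phi : (H -> H) -> R) : Prop :=
  forall X U V, I X -> M U -> unitary U -> M V -> unitary V ->
    Phi (U \o X \o V) = Phi X.

Definition norm_dominating (R : realType) (H : hilbertSpace R)
    (I : set (H -> H)) (Phi : (H -> H) -> R) : Prop :=
  forall X, I X -> opnorm X <= Phi X.

(* For operators in a von Neumann algebra M, the spectrum relative to M is the
   same as this one, relative to all bounded operators. *)
Definition spectrum (R : realType) (H : hilbertSpace R) (T : H -> H) :
  set R[i]^o :=
  [set z : R[i]^o | ~ exists S, [/\ bounded_op S,
     S \o (T - (z : R[i]) *: idfun) = idfun &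
     (T - (z : R[i]) *: idfun) \o S = idfun]].

(* Main.v *)
(* (1) => (2). Choose a boundary point l of the spectrum of T and l' close to l
   outside it. As T - l is not bounded below, some nonzero spectral projection P
   of |T - l| makes (T - l) P small, and (1) gives a nonzero projection E <= P in
   I with Phi E bounded independently of P. Then X = (l' - T) E is small, and
   T + X = (T - l') (1 - E) + l' has l' as an isolated spectral point. If l' were
   the only one, T + X - l' would be quasinilpotent although it is invertible on
   the quotient by the range of E.
   (2) => (1). If (1) fails there are projections P_n below which Phi >= n on
   all nonzero projections of I. Any E in I is orthogonal to P_n for large n,
   because E A P_n <> 0 would produce a projection below P_n with Phi at most
   8 Phi E. This yields nonzero orthogonal E_k in I such that X E_k and E_k X are
   as small as we please, uniformly for X in I with Phi X < 1/2. The operator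
   T = sum_k l_k E_k, with (l_k) dense in the unit disc and |l_k| <= 1 - 2^(-k-1),
   is such that T + X has the closed unit disc as spectrum for every such X.
   Everything rests on spectral projections inside M. They come from the
   projection onto the kernel of |N| - N, where the square root is obtained by
   iteration; the same square root writes self-adjoint contractions as averages
   of two unitaries, which bounds Phi (A X) by 2 |A| Phi X. *)
From HB Require Import structures.
Require Import Defs.
From mathcomp Require Import all_boot all_order all_algebra.
From mathcomp Require Import sesquilinear complex.
From mathcomp Require Import all_classical all_reals all_analysis.
From mathcomp Require Import ring lra.
Import Order.TTheory GRing.Theory Num.Theory.
Import numFieldNormedType.Exports.
Set Implicit Arguments.
Unset Strict Implicit.
Unset Printing Implicit Defensive.
Local Open Scope classical_set_scope.
Local Open Scope ring_scope.
Local Open Scope complex_scope.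

(** * Real-valued norms and limits of sequences *)

Section RealNorm.
Variables (R : realType) (V : normedModType R[i]).
Implicit Types (x y z : V) (a : R[i]).

Lemma rnormE (W : normedZmodType R[i]) (x : W) : (rnorm x)%:C = `|x|.
Proof. by rewrite RRe_real // normr_real. Qed.

Lemma rnorm_ge0 (W : normedZmodType R[i]) (x : W) : 0 <= rnorm x.
Proof. by rewrite -ler0c rnormE. Qed.

Lemma rnormD (W : normedZmodType R[i]) (x y : W) :
  rnorm (x + y) <= rnorm x + rnorm y.
Proof. by rewrite -lecR rmorphD /= !rnormE ler_normD. Qed.

Lemma rnormN (W : normedZmodType R[i]) (x : W) : rnorm (- x) = rnorm x.
Proof. by rewrite /rnorm normrN. Qed.

Lemma rnormBC (W : normedZmodType R[i]) (x y : W) : rnorm (x - y) = rnorm (y - x).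
Proof. by rewrite -rnormN opprB. Qed.

Lemma rnorm0 (W : normedZmodType R[i]) : rnorm (0 : W) = 0.
Proof. by rewrite /rnorm normr0. Qed.

Lemma rnorm_eq0 (W : normedZmodType R[i]) (x : W) : rnorm x = 0 -> x = 0.
Proof.
by move=> x0; apply/eqP; rewrite -normr_eq0 -rnormE x0.
Qed.

Lemma rnorm_gt0 (W : normedZmodType R[i]) (x : W) : x <> 0 -> 0 < rnorm x.
Proof.
by move=> x0; rewrite lt_neqAle rnorm_ge0 andbT; apply/eqP => /esym/rnorm_eq0.
Qed.

Lemma rnormB (W : normedZmodType R[i]) (x y : W) :
  rnorm (x - y) <= rnorm x + rnorm y.
Proof. by rewrite -(rnormN y) rnormD. Qed.

Lemma rnorm_dist (W : normedZmodType R[i]) (x y z : W) :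
  rnorm (x - z) <= rnorm (x - y) + rnorm (y - z).
Proof. by rewrite -[x - z](subrKA y) rnormD. Qed.

Lemma rnormBl (W : normedZmodType R[i]) (x y : W) :
  rnorm x - rnorm y <= rnorm (x - y).
Proof. by rewrite lerBlDr -{1}(subrK y x) rnormD. Qed.

Lemma rnormZ a x : rnorm (a *: x) = rnorm a * rnorm x.
Proof. by apply: complexI; rewrite rmorphM /= !rnormE normrZ. Qed.

Lemma rnormM (a b : R[i]) : rnorm (a * b) = rnorm a * rnorm b.
Proof. by apply: complexI; rewrite rmorphM /= !rnormE normrM. Qed.

Lemma rnorm_real (r : R) : rnorm r%:C = `|r|.
Proof.
by apply: complexI; rewrite rnormE normc_def /= expr0n addr0 sqrtr_sqr.
Qed.

Lemma rnorm_realZ (r : R) x : 0 <= r -> rnorm (r%:C *: x) = r * rnorm x.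
Proof. by move=> r0; rewrite rnormZ rnorm_real ger0_norm. Qed.

Lemma rnorm1 : rnorm (1 : R[i]) = 1.
Proof. by rewrite /rnorm normr1. Qed.

Lemma rnormV a : rnorm a^-1 = (rnorm a)^-1.
Proof. by apply: complexI; rewrite fmorphV /= !rnormE normfV. Qed.

Lemma rnorm_i : rnorm ('i : R[i]) = 1.
Proof. by rewrite /rnorm normc_def /= expr0n add0r expr1n sqrtr1. Qed.

Lemma rnorm_Re a : `|complex.Re a| <= rnorm a.
Proof. by rewrite -lecR rnormE normc_ge_Re. Qed.

(** Sequential convergence with tolerances in [R] rather than [R[i]], so that all estimates take
    place in an ordered field. *)
Definition slim (u : nat -> V) (l : V) := forall e : R, 0 < e ->
  exists N, forall n, (N <= n)%N -> rnorm (u n - l) < e.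

Lemma slim_unique u l l' : slim u l -> slim u l' -> l = l'.
Proof.
move=> ul ul'; apply/eqP; rewrite -subr_eq0; apply/eqP/rnorm_eq0/eqP.
rewrite eq_le rnorm_ge0 andbT; apply/ler_addgt0Pl => e e0; rewrite addr0.
have [N uN] := ul (e / 2) ltac:(lra); have [N' uN'] := ul' (e / 2) ltac:(lra).
have := uN (maxn N N') (leq_maxl _ _); have := uN' (maxn N N') (leq_maxr _ _).
have := rnorm_dist l (u (maxn N N')) l'; rewrite (rnormBC l (u _)); lra.
Qed.

Lemma slim_cst l : slim (fun=> l) l.
Proof. by move=> e e0; exists 0; rewrite subrr rnorm0. Qed.

Lemma slimD u v l m : slim u l -> slim v m -> slim (fun n => u n + v n) (l + m).
Proof.
move=> ul vm e e0.
have [N uN] := ul (e / 2) ltac:(lra); have [N' vN] := vm (e / 2) ltac:(lra).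
exists (maxn N N') => n; rewrite geq_max => /andP[/uN un /vN vn].
by have := rnormD (u n - l) (v n - m); rewrite addrACA -opprD; lra.
Qed.

Lemma slimZ a u l : slim u l -> slim (fun n => a *: u n) (a *: l).
Proof.
move=> ul e e0; have a0 := rnorm_ge0 a.
have [N uN] := ul (e / (rnorm a + 1)) ltac:(apply: divr_gt0; lra).
exists N => n /uN; rewrite -scalerBr rnormZ ltr_pdivlMr; last by lra.
by have := rnorm_ge0 (u n - l); nra.
Qed.

Lemma slim_le u l c : slim u l -> (forall n, rnorm (u n) <= c) -> rnorm l <= c.
Proof.
move=> ul uc; apply/ler_addgt0Pl => e e0; have [N /(_ N (leqnn _))] := ul e e0.
by have := uc N; have := rnormBl l (u N); rewrite rnormBC; lra.
Qed.

Lemma slim_sub u l (f : nat -> nat) : (forall n, (n <= f n)%N) ->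
  slim u l -> slim (fun n => u (f n)) l.
Proof.
move=> fn ul e /ul[N uN]; exists N => n Nn; apply: uN; exact: leq_trans (fn n).
Qed.

End RealNorm.

Lemma slim_cauchy (R : realType) (V : completeNormedModType R[i]) (u : nat -> V) :
  (forall e : R, 0 < e -> exists N, forall m n, (N <= n)%N -> (n <= m)%N ->
      rnorm (u m - u n) < e) ->
  exists l, slim u l.
Proof.
move=> uC; suff /cauchy_cvgP/cvgrPdist_lt ul : cauchy (u @ \oo).
  exists (lim (u @ \oo)) => e e0; have := ul e%:C; rewrite ltcR => /(_ e0)[N _ uN].
  by exists N => n /uN /=; rewrite -rnormE ltcR rnormBC.
apply/cauchy_ballP => e; rewrite ltcE => /andP[/eqP /= ei e0].
have [|N uN] := uC (complex.Re e / 2); first by lra.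
have eE : e = (complex.Re e)%:C by rewrite RRe_real// realE lecE ei eqxx (ltW e0).
exists (u @` [set n | (N <= n)%N], u @` [set n | (N <= n)%N]) => /=.
  by split; exists N => // n Nn; exists n.
case=> _ _ /= [[m Nm <-] [n Nn <-]]; rewrite -ball_normE/= eE -rnormE ltcR.
have := uN _ _ (leqnn N) Nm; have := uN _ _ (leqnn N) Nn.
by have := rnorm_dist (u m) (u N) (u n); rewrite (rnormBC (u N)); lra.
Qed.

(** * The real part of the inner product and adjoints *)

Section Inner.
Variables (R : realType) (H : hilbertSpace R).
Implicit Types (x y z : H) (a : R[i]).

(** A symmetric real bilinear form with ordered values; [inner_rip] recovers the complex inner
    product from it. *)
Definition rip x y : R := complex.Re (inner H x y).

Lemma ripC x y : rip x y = rip y x.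
Proof.
rewrite /rip (hermC (inner H)) /= expr0 mul1r.
by case: (inner H y x) => p q.
Qed.

Lemma ripDl x y z : rip (x + y) z = rip x z + rip y z.
Proof. by rewrite /rip linearDl raddfD. Qed.

Lemma ripNl x y : rip (- x) y = - rip x y.
Proof. by rewrite /rip linearNl raddfN. Qed.

Lemma ripBl x y z : rip (x - y) z = rip x z - rip y z.
Proof. by rewrite ripDl ripNl. Qed.

Lemma ripZl (r : R) x y : rip (r%:C *: x) y = r * rip x y.
Proof.
rewrite /rip linearZl_LR /=; case: (inner H x y) => p q /=; rewrite mul0r subr0 //.
Qed.

Lemma ripDr x y z : rip z (x + y) = rip z x + rip z y.
Proof. by rewrite ripC ripDl !(ripC z). Qed.

Lemma ripNr x y : rip x (- y) = - rip x y.
Proof. by rewrite ripC ripNl ripC. Qed.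

Lemma ripBr x y z : rip z (x - y) = rip z x - rip z y.
Proof. by rewrite ripDr ripNr. Qed.

Lemma ripZr (r : R) x y : rip x (r%:C *: y) = r * rip x y.
Proof. by rewrite ripC ripZl ripC. Qed.

Lemma ripxx x : rip x x = rnorm x ^+ 2.
Proof. by apply: complexI; rewrite /rip -inner_normE -rnormE -rmorphXn. Qed.

(** Cauchy-Schwarz, read off from the square of the triangle inequality for the given norm. *)
Lemma rip_le x y : rip x y <= rnorm x * rnorm y.
Proof.
have := rnormD x y; rewrite -(ler_pXn2r (n := 2)) ?nnegrE ?addr_ge0 ?rnorm_ge0//.
rewrite -ripxx ripDl !ripDr (ripC y x) !ripxx; nra.
Qed.

Lemma rip_ge x y : - (rnorm x * rnorm y) <= rip x y.
Proof. by have := rip_le (- x) y; rewrite rnormN ripNl; lra. Qed.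

Lemma inner_rip x y : inner H x y = rip x y +i* rip x ('i *: y).
Proof.
have iE : inner H x ('i *: y) = Num.conj 'i * inner H x y by exact: linearZr_LR.
rewrite /rip iE; case: (inner H x y) => p q.
by congr (_ +i* _) => /=; ring.
Qed.

Definition radj (A B : H -> H) := forall x y, rip (A x) y = rip x (B y).

Lemma adjoint_radj A B : adjoint_of A B -> radj A B.
Proof. by move=> AB x y; rewrite /rip AB. Qed.

(** The imaginary part of an inner product is the real part taken against ['i *: y], and a linear
    [B] commutes with multiplication by ['i]; so adjointness may be tested on real parts alone. *)
Lemma radj_adjoint A B : linear B -> radj A B -> adjoint_of A B.
Proof.
move=> Bl AB x y; rewrite !inner_rip AB.
have B0 : B 0 = 0 by have := Bl (-1) 0 0; rewrite scaler0 addr0 scaleN1r addNr.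
have -> : 'i *: B y = B ('i *: y) by have := Bl 'i y 0; rewrite B0 !addr0.
by rewrite AB.
Qed.

Lemma radj_sym A B : radj A B -> radj B A.
Proof. by move=> AB x y; rewrite ripC -AB ripC. Qed.

Lemma rip_inj x y : (forall z, rip x z = rip y z) -> x = y.
Proof.
move=> xy; apply/eqP; rewrite -subr_eq0; apply/eqP/rnorm_eq0/eqP.
by rewrite -sqrf_eq0 -ripxx ripBl xy subrr.
Qed.

Lemma slim_rip u l y : slim u l -> forall e : R, 0 < e ->
  exists N, forall n, (N <= n)%N -> `|rip (u n) y - rip l y| < e.
Proof.
move=> ul e e0; have y0 := rnorm_ge0 y.
have [N uN] := ul (e / (rnorm y + 1)) ltac:(apply: divr_gt0; lra).
exists N => n /uN; rewrite ltr_pdivlMr; last by lra.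
rewrite -ripBl => h; have := rip_le (u n - l) y; have := rip_ge (u n - l) y.
have := rnorm_ge0 (u n - l); rewrite ltr_norml; nra.
Qed.

Lemma slim_inner u l y : slim u l -> slim (fun n => inner H (u n) y : R[i]^o) (inner H l y).
Proof.
move=> ul e e0.
have [N uN] := slim_rip y ul (e := e / 2) ltac:(lra).
have [N' uN'] := slim_rip ('i *: y) ul (e := e / 2) ltac:(lra).
exists (maxn N N') => n; rewrite geq_max => /andP[/uN un /uN' un'].
rewrite !inner_rip.
have -> : rip (u n) y +i* rip (u n) ('i *: y) - (rip l y +i* rip l ('i *: y)) =
  (rip (u n) y - rip l y)%:C + 'i * (rip (u n) ('i *: y) - rip l ('i *: y))%:C.
  by apply/eqP; rewrite eq_complex /=; apply/andP; split; apply/eqP; ring.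
by apply: (le_lt_trans (rnormD _ _)); rewrite rnormM rnorm_i !rnorm_real; lra.
Qed.

Lemma radj_slim (A B : nat -> H -> H) A' B' : (forall n, radj (A n) (B n)) ->
  (forall x, slim (A ^~ x) (A' x)) -> (forall x, slim (B ^~ x) (B' x)) ->
  radj A' B'.
Proof.
move=> AB AA BB x y; apply/eqP; rewrite -subr_eq0 -normr_eq0 eq_le normr_ge0 andbT.
apply/ler_addgt0Pl => e e0; rewrite addr0.
have [N uN] := slim_rip y (AA x) (e := e / 2) ltac:(lra).
have [N' uN'] := slim_rip x (BB y) (e := e / 2) ltac:(lra).
have := uN _ (leq_maxl N N'); have := uN' _ (leq_maxr N N').
by rewrite AB (ripC x (B' y)) (ripC x) !(ltr_norml, ler_norml); lra.
Qed.
End Inner.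

(** * The ring of bounded operators and the operator norm *)

Section BoundedOperators.
Variables (R : realType) (H : hilbertSpace R).

Definition bounded_opb : {pred H -> H} := [pred T | `[< bounded_op T >]].

Lemma bounded_opb_closed : GRing.subsemimod_closed bounded_opb.
Proof.
split; first split.
- apply/asboolP; split; first by move=> a x y; rewrite /= scaler0 addr0.
  by exists 0 => x; rewrite mul0r rnorm0.
- move=> S T /asboolP[Sl [c Sc]] /asboolP[Tl [d Td]]; apply/asboolP; split.
    by move=> a x y; rewrite !fctE Sl Tl scalerDr addrACA.
  exists (c + d) => x; rewrite fctE mulrDl.
  exact: le_trans (rnormD _ _) (lerD (Sc x) (Td x)).
- move=> a T /asboolP[Tl [d Td]]; apply/asboolP; split.
    by move=> b x y; rewrite !fctE Tl scalerDr !scalerA mulrC.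
  exists (rnorm a * d) => x; rewrite fctE rnormZ -mulrA.
  by rewrite ler_wpM2l ?rnorm_ge0.
Qed.

HB.instance Definition _ := GRing.isSubSemiModClosed.Build R[i] (H -> H) bounded_opb bounded_opb_closed.

(** Bounded operators as a type, so that composition becomes the product of a ring. The ring may be
    trivial, since [H] may be zero. *)
Record bop := Bop { bopf :> H -> H ; _ : bopf \in bounded_opb }.

HB.instance Definition _ := [isSub for bopf].
HB.instance Definition _ := [Choice of bop by <:].
HB.instance Definition _ := [SubChoice_isSubLmodule of bop by <:].

Implicit Types (A B S T : bop) (x y : H) (a : R[i]).

Lemma bop_bounded A : bounded_op A.
Proof. by case: A => A AP; exact/asboolP. Qed.

Definition mkbop (T : H -> H) (Tb : bounded_op T) : bop :=
  Bop (introT (asboolP (bounded_op T)) Tb : T \in bounded_opb).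

Lemma bopP A B : A =1 B -> A = B.
Proof. by move=> AB; apply/val_inj/funext. Qed.

Lemma bop_linear A : linear A.
Proof. by case: (bop_bounded A). Qed.

HB.instance Definition _ A := GRing.isLinear.Build R[i] H H _ (bopf A) (bop_linear A).

Lemma bopDE A B x : (A + B) x = A x + B x. Proof. by []. Qed.
Lemma bopNE A x : (- A) x = - A x. Proof. by []. Qed.
Lemma bopZE a A x : (a *: A) x = a *: A x. Proof. by []. Qed.
Lemma bop0E x : (0 : bop) x = 0. Proof. by []. Qed.

Lemma bop_scale A a x : A (a *: x) = a *: A x. Proof. exact: linearZ. Qed.
Lemma bop_sub A x y : A (x - y) = A x - A y. Proof. exact: linearB. Qed.

Lemma bounded_op1 : bounded_op (idfun : H -> H).
Proof. by split=> //; exists 1 => x; rewrite mul1r. Qed.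

Lemma bounded_op_comp A B : bounded_op (A \o B).
Proof.
have [Al [c Ac]] := bop_bounded A; have [Bl [d Bd]] := bop_bounded B.
split; first by move=> a x y; rewrite /= Bl Al.
exists (`|c| * d) => x /=; apply: le_trans (Ac _) _.
apply: (@le_trans _ _ (`|c| * rnorm (B x))).
  by rewrite ler_wpM2r ?rnorm_ge0 ?ler_norm.
by rewrite -mulrA ler_wpM2l.
Qed.

Let one := mkbop bounded_op1.
Let mul A B := mkbop (bounded_op_comp A B).

Let comp_mulA : associative mul. Proof. by move=> A B C; exact: bopP. Qed.
Let comp_mul1 : left_id one mul. Proof. by move=> A; exact: bopP. Qed.
Let comp_mulr1 : right_id one mul. Proof. by move=> A; exact: bopP. Qed.
Let comp_mulDl : left_distributive mul +%R. Proof. by move=> A B C; exact: bopP. Qed.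
Let comp_mulDr : right_distributive mul +%R.
Proof. by move=> A B C; apply: bopP => x; exact: raddfD. Qed.

HB.instance Definition _ := GRing.Zmodule_isPzRing.Build bop comp_mulA comp_mul1
  comp_mulr1 comp_mulDl comp_mulDr.

Lemma bop1E x : (1 : bop) x = x. Proof. by []. Qed.
Lemma bopME A B x : (A * B) x = A (B x). Proof. by []. Qed.

Lemma bop_scaleAl a A B : a *: (A * B) = (a *: A) * B.
Proof. exact: bopP. Qed.

Lemma bop_scaleAr a A B : a *: (A * B) = A * (a *: B).
Proof. by apply: bopP => x; rewrite bopZE !bopME bopZE linearZ. Qed.

Definition bnorm (A : bop) : R := opnorm A.

Let normset A := [set rnorm (A x) | x in [set x : H | rnorm x <= 1]].

Lemma normset_ubound A (c : R) : 0 <= c -> (forall x, rnorm (A x) <= c * rnorm x) ->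
  ubound (normset A) c.
Proof.
move=> c0 Ac _ [x /= x1 <-]; apply: (le_trans (Ac x)).
by rewrite -[leRHS]mulr1 ler_wpM2l.
Qed.

Lemma normset_has_sup A : has_sup (normset A).
Proof.
split; first by exists (rnorm (A 0)); exists 0 => //=; rewrite rnorm0.
have [_ [c Ac]] := bop_bounded A; exists `|c|; apply: normset_ubound => // x.
by apply: (le_trans (Ac x)); rewrite ler_wpM2r ?rnorm_ge0 ?ler_norm.
Qed.

Lemma bnorm_le A (c : R) : 0 <= c -> (forall x, rnorm (A x) <= c * rnorm x) ->
  bnorm A <= c.
Proof.
move=> c0 Ac; apply: ge_sup; last exact: normset_ubound.
by case: (normset_has_sup A).
Qed.

Lemma bnorm_ge0 A : 0 <= bnorm A.
Proof.
apply: (le_trans (rnorm_ge0 (A 0))); apply: sup_ubound.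
  by case: (normset_has_sup A).
by exists 0 => //=; rewrite rnorm0.
Qed.

Lemma rnorm_bop A x : rnorm (A x) <= bnorm A * rnorm x.
Proof.
have [->|/eqP x0] := eqVneq x 0; first by rewrite linear0 rnorm0 mulr0.
have n0 := rnorm_gt0 x0.
have : rnorm (A ((rnorm x)^-1%:C *: x)) <= bnorm A.
  apply: sup_ubound; first by case: (normset_has_sup A).
  by exists ((rnorm x)^-1%:C *: x) => //=; rewrite rnorm_realZ ?mulVf ?invr_ge0 ?rnorm_ge0 ?gt_eqF.
by rewrite linearZ rnorm_realZ ?invr_ge0 ?rnorm_ge0// mulrC ler_pdivrMr.
Qed.

Lemma rnorm_bop_le A (c : R) x : bnorm A <= c -> rnorm (A x) <= c * rnorm x.
Proof. by move=> Ac; apply: (le_trans (rnorm_bop A x)); rewrite ler_wpM2r ?rnorm_ge0. Qed.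

Lemma bnormD A B : bnorm (A + B) <= bnorm A + bnorm B.
Proof.
apply: bnorm_le => [|x]; first by rewrite addr_ge0 ?bnorm_ge0.
by rewrite mulrDl; apply: (le_trans (rnormD _ _)); rewrite lerD ?rnorm_bop.
Qed.

Lemma bnormM A B : bnorm (A * B) <= bnorm A * bnorm B.
Proof.
apply: bnorm_le => [|x]; first by rewrite mulr_ge0 ?bnorm_ge0.
rewrite bopME; apply: (le_trans (rnorm_bop A (B x))); rewrite -mulrA.
by rewrite ler_wpM2l ?bnorm_ge0 ?rnorm_bop.
Qed.

Lemma bnormM_le A B (c d : R) : bnorm A <= c -> bnorm B <= d ->
  bnorm (A * B) <= c * d.
Proof.
move=> Ac Bd; apply: (le_trans (bnormM A B)).
by rewrite ler_pM ?bnorm_ge0.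
Qed.

Lemma bnormN A : bnorm (- A) = bnorm A.
Proof.
rewrite /bnorm /opnorm; congr (sup _); rewrite predeqE => r.
by split=> -[x x1 <-]; exists x => //; rewrite bopNE rnormN.
Qed.

Lemma bnormB A B : bnorm (A - B) <= bnorm A + bnorm B.
Proof. by rewrite -(bnormN B) bnormD. Qed.

Lemma bnormZ_le a A : bnorm (a *: A) <= rnorm a * bnorm A.
Proof.
apply: bnorm_le => [|x]; first by rewrite mulr_ge0 ?rnorm_ge0 ?bnorm_ge0.
by rewrite bopZE rnormZ -mulrA ler_wpM2l ?rnorm_ge0 ?rnorm_bop.
Qed.

Lemma bnorm1_le : bnorm 1 <= 1.
Proof. by apply: bnorm_le => // x; rewrite mul1r. Qed.

Lemma bnorm0 : bnorm 0 = 0.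
Proof.
by apply/eqP; rewrite eq_le bnorm_ge0 bnorm_le// => x; rewrite bop0E rnorm0 mul0r.
Qed.

Lemma bnormX_le A (c : R) n : bnorm A <= c -> bnorm (A ^+ n) <= c ^+ n.
Proof.
move=> Ac; elim: n => [|n IHn]; first by rewrite !expr0 bnorm1_le.
by rewrite !exprS; exact: bnormM_le.
Qed.

Lemma bnorm_eq0 A : bnorm A <= 0 -> A = 0.
Proof.
move=> A0; apply: bopP => x; apply: rnorm_eq0; apply/eqP.
by rewrite eq_le rnorm_ge0 andbT; apply: (le_trans (rnorm_bop_le x A0)); rewrite mul0r.
Qed.

Lemma bop_slim A u l : slim u l -> slim (A \o u) (A l).
Proof.
move=> ul e e0; have A0 := bnorm_ge0 A.
have [N uN] := ul (e / (bnorm A + 1)) ltac:(apply: divr_gt0; lra).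
exists N => n /uN; rewrite ltr_pdivlMr /=; last by lra.
rewrite -linearB => h; have := rnorm_bop A (u n - l).
by have := rnorm_ge0 (u n - l); nra.
Qed.

(** Pointwise limits exist by completeness of [H], and linearity and the bound pass to the limit.
    Only strong convergence is asked for, which also covers sequences that do not converge in
    norm. *)
Lemma bop_limit (S : nat -> bop) (c : R) : (forall n, bnorm (S n) <= c) ->
  (forall x (e : R), 0 < e -> exists N, forall m n, (N <= n)%N -> (n <= m)%N ->
     rnorm (S m x - S n x) < e) ->
  exists2 T : bop, forall x, slim (fun n => S n x) (T x) & bnorm T <= c.
Proof.
move=> Sc SC; have c0 : 0 <= c by apply: le_trans (Sc 0%N); exact: bnorm_ge0.
have /choice[T ST] x : exists l, slim (fun n => S n x) l by apply: slim_cauchy; exact: SC.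
have Tc x : rnorm (T x) <= c * rnorm x.
  by apply: slim_le (ST x) _ => n; exact: rnorm_bop_le.
have Tb : bounded_op T.
  split; last by exists c.
  move=> a x y; apply: slim_unique (ST _) _.
  have := slimD (slimZ a (ST x)) (ST y).
  by under eq_fun do rewrite -linearP.
by exists (mkbop Tb) => //; apply: bnorm_le.
Qed.

(* Norm Cauchy sequences are controlled by a bounded monotone real sequence,
   which spares us the completeness of the space of operators. *)
Lemma bop_limit_monotone (S : nat -> bop) (c : nat -> R) (d : R) :
  (forall n, c n <= d) -> bnorm (S 0%N) <= c 0%N ->
  (forall n, bnorm (S n.+1 - S n) <= c n.+1 - c n) ->
  exists2 T : bop, forall x, slim (fun n => S n x) (T x) & bnorm T <= d.
Proof.
move=> cd S0 Sc.
have Sck n k : bnorm (S (n + k)%N - S n) <= c (n + k)%N - c n.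
  elim: k => [|k IHk]; first by rewrite addn0 !subrr bnorm0.
  rewrite addnS -(subrKA (S (n + k)%N)); apply: (le_trans (bnormD _ _)).
  by have := Sc (n + k)%N; lra.
have Scle n : bnorm (S n) <= d.
  rewrite -(subrK (S 0%N) (S n)); apply: (le_trans (bnormD _ _)).
  by have := Sck 0%N n; have := cd n; rewrite add0n; lra.
apply: bop_limit Scle _ => x e e0.
have cm n k : c n <= c (n + k)%N.
  by have := Sck n k; have := bnorm_ge0 (S (n + k)%N - S n); lra.
have [x0 r0] : 0 <= rnorm x /\ 0 < e / (rnorm x + 1).
  by have := rnorm_ge0 x; split=> //; apply: divr_gt0; lra.
have cs : has_sup (range c).
  by split; [exists (c 0%N); exists 0%N | exists d => _ [n _ <-]].
have [_ [N _ <-] cN] := sup_adherent r0 cs.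
exists N => m n Nn nm.
have [mE nE] : m = (n + (m - n))%N /\ n = (N + (n - N))%N by rewrite !subnKC.
have cmu : c m <= sup (range c).
  by apply: sup_ubound; [case: cs | exists m].
have cNn : c N <= c n by rewrite nE cm.
have Smn : bnorm (S m - S n) <= c m - c n by rewrite mE; apply: Sck.
have : bnorm (S m - S n) < e / (rnorm x + 1) by lra.
rewrite ltr_pdivlMr; last by lra.
have := rnorm_bop (S m - S n) x; have := bnorm_ge0 (S m - S n).
rewrite bopDE bopNE; nra.
Qed.

End BoundedOperators.

(** * Algebra of adjoints and strong limits *)

Section Adjoints.
Variables (R : realType) (H : hilbertSpace R).
Implicit Types (A B C S T : bop H) (x y : H) (a : R[i]).

Lemma radj1 : radj (1 : bop H) (1 : bop H). Proof. by []. Qed.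

Lemma radj0 : radj (0 : bop H) (0 : bop H).
Proof. by move=> x y; rewrite !bop0E /rip linear0l linear0r. Qed.

Lemma radjD A B A' B' : radj A B -> radj A' B' -> radj (A + A') (B + B').
Proof. by move=> AB AB' x y; rewrite !bopDE ripDl ripDr AB AB'. Qed.

Lemma radjN A B : radj A B -> radj (- A) (- B).
Proof. by move=> AB x y; rewrite !bopNE ripNl ripNr AB. Qed.

Lemma radjB A B A' B' : radj A B -> radj A' B' -> radj (A - A') (B - B').
Proof. by move=> AB AB'; apply: radjD => //; exact: radjN. Qed.

Lemma radjZ (r : R) A B : radj A B -> radj (r%:C *: A) (r%:C *: B).
Proof. by move=> AB x y; rewrite !bopZE ripZl ripZr AB. Qed.

Lemma rip_i (x y : H) : rip ('i *: x) y = - rip x ('i *: y).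
Proof.
have iE : inner H x ('i *: y) = Num.conj 'i * inner H x y by exact: linearZr_LR.
rewrite /rip iE linearZl_LR /=; case: (inner H x y) => p q /=; ring.
Qed.

Lemma radj_i A B : radj A B -> radj ('i *: A) (- ('i *: B)).
Proof. by move=> AB x y; rewrite bopNE !bopZE rip_i AB linearZ ripNr. Qed.

Lemma radjM A B A' B' : radj A B -> radj A' B' -> radj (A * A') (B' * B).
Proof. by move=> AB AB' x y; rewrite !bopME AB AB'. Qed.

Lemma radjX A n : radj A A -> radj (A ^+ n) (A ^+ n).
Proof.
move=> AA; elim: n => [|n IHn]; first by rewrite expr0; exact: radj1.
by rewrite {1}exprS exprSr; exact: radjM.
Qed.

Lemma radj_uniq A B C : radj A B -> radj A C -> B = C.
Proof.
by move=> BA CA; apply: bopP => x; apply: rip_inj => z; rewrite ripC -BA CA ripC.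
Qed.

Lemma sa_sqr_norm A x : radj A A -> rip ((A * A) x) x = rnorm (A x) ^+ 2.
Proof. by move=> AA; rewrite bopME AA ripxx. Qed.

(** Multiplication is strongly continuous when the left factors are bounded: split
    [S n (T n x) - S' (T' x)] at [S n (T' x)]. *)
Lemma slim_bopM (S T : nat -> bop H) (S' T' : bop H) (c : R) :
  (forall n, bnorm (S n) <= c) ->
  (forall x, slim (fun n => S n x) (S' x)) ->
  (forall x, slim (fun n => T n x) (T' x)) ->
  forall x, slim (fun n => (S n * T n) x) ((S' * T') x).
Proof.
move=> Sc SS TT x e e0; have c0 : 0 <= c by apply: le_trans (Sc 0%N); exact: bnorm_ge0.
have [N SN] := SS (T' x) (e / 2) ltac:(lra).
have [N' TN] := TT x (e / 2 / (c + 1)) ltac:(apply: divr_gt0; lra).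
exists (maxn N N') => n; rewrite geq_max => /andP[/SN Sn /TN].
rewrite ltr_pdivlMr; last by lra.
move=> Tn; rewrite !bopME.
have := rnorm_dist (S n (T n x)) (S n (T' x)) (S' (T' x)).
rewrite -linearB; have := rnorm_bop_le (T n x - T' x) (Sc n).
have := rnorm_ge0 (T n x - T' x); nra.
Qed.

Lemma comm_slim (S : nat -> bop H) (S' B : bop H) :
  (forall x, slim (fun n => S n x) (S' x)) -> (forall n, GRing.comm (S n) B) ->
  GRing.comm S' B.
Proof.
move=> SS SB; apply: bopP => x; rewrite !bopME.
apply: slim_unique (SS (B x)) _; have := bop_slim B (SS x); congr (slim _ _).
by apply: funext => n /=; rewrite -!bopME SB.
Qed.

Lemma radj_sa_slim (S : nat -> bop H) (S' : bop H) :
  (forall x, slim (fun n => S n x) (S' x)) -> (forall n, radj (S n) (S n)) ->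
  radj S' S'.
Proof. by move=> SS SA; exact: (radj_slim SA). Qed.

Lemma comm_scale a A B : GRing.comm A B -> GRing.comm (a *: A) B.
Proof. by move=> AB; rewrite /GRing.comm -bop_scaleAl AB bop_scaleAr. Qed.

End Adjoints.

(** * Membership in a von Neumann algebra *)

Definition bmem (R : realType) (H : hilbertSpace R) (M : set (H -> H)) (A : bop H) :=
  M A.

Section VonNeumann.
Variables (R : realType) (H : hilbertSpace R) (M : set (H -> H)).
Hypothesis hM : von_neumann_algebra M.
Implicit Types (A B C S T P : bop H) (x y : H) (a : R[i]).

Notation inM := (bmem M).

Lemma inM_bop (F : H -> H) : M F -> exists2 A, inM A & bopf A = F.
Proof. by move=> MF; exists (mkbop (vna_bounded hM MF)). Qed.

Lemma inM1 : inM 1. Proof. exact: (vna_one hM). Qed.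
Lemma inMD A B : inM A -> inM B -> inM (A + B). Proof. exact: (vna_add hM). Qed.
Lemma inMZ a A : inM A -> inM (a *: A). Proof. exact: (vna_scale hM). Qed.
Lemma inMM A B : inM A -> inM B -> inM (A * B). Proof. exact: (vna_mul hM). Qed.
Lemma inM0 : inM 0. Proof. by rewrite -(scale0r (1 : bop H)); exact/inMZ/inM1. Qed.
Lemma inMN A : inM A -> inM (- A). Proof. by rewrite -scaleN1r; exact: inMZ. Qed.
Lemma inMB A B : inM A -> inM B -> inM (A - B). Proof. by move=> MA /inMN; exact: inMD. Qed.

Lemma inMX A n : inM A -> inM (A ^+ n).
Proof.
by move=> MA; elim: n => [|n IHn]; rewrite ?expr0 ?exprS; [exact: inM1|exact: inMM].
Qed.

Lemma inM_adj A : inM A -> exists2 B, inM B & radj A B.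
Proof.
move=> MA; have [B0 MB0 AB] := vna_adjoint hM MA.
by have [B MB BE] := inM_bop MB0; exists B => //; rewrite BE; exact: adjoint_radj.
Qed.

(** Strong convergence makes every matrix coefficient converge, and the weak-operator topology is
    the initial one for these coefficients. Through [inM_slim], operators built by iteration stay in
    [M]. *)
Lemma wot_slim (A : set (H -> H)) (S : nat -> H -> H) (T : H -> H) :
  (forall n, A (S n)) -> (forall x, slim (fun n => S n x) (T x)) -> wot_closure A T.
Proof.
move=> AS ST U [_ [[V Vo <-] VT VU]].
have cvS : {ptws, (fun n => matrix_coef (S n)) @ \oo --> matrix_coef T}.
  apply/pointwise_cvgP => -[x y]; apply/cvgrPdist_lt => e.
  rewrite ltcE => /andP[/eqP /= ei e0].
  have [N SN] := slim_inner y (ST x) e0; exists N => // n /SN.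
  by rewrite -ltcR rnormE RRe_real ?realE ?lecE ?ei ?eqxx ?(ltW e0)// distrC.
have [N _ /(_ N (leqnn N)) /= VS] := cvS V (open_nbhs_nbhs (conj Vo VT)).
by exists (S N); split; [exact: AS | apply: VU].
Qed.

Lemma inM_slim (S : nat -> bop H) T : (forall n, inM (S n)) ->
  (forall x, slim (fun n => S n x) (T x)) -> inM T.
Proof.
move=> MS ST; apply: (vna_closed hM); split; first exact: bop_bounded.
exact: wot_slim MS ST.
Qed.

End VonNeumann.

(** * Square roots and kernel projections *)

Section Spectral.
Variables (R : realType) (H : hilbertSpace R) (M : set (H -> H)).
Hypothesis hM : von_neumann_algebra M.
Implicit Types (A B C S T P W : bop H) (x y : H) (a : R[i]).

Notation inM := (bmem M).
Notation half := ((2^-1 : R)%:C).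

Lemma half_half (V : lmodType R[i]) (v : V) : half *: v + half *: v = v.
Proof. have h1 : 2^-1 + 2^-1 = 1 :> R by lra.
by rewrite -scalerDl -rmorphD /= h1 scale1r. Qed.

(* X is the limit of the iteration X_(n+1) = (C + X_n^2) / 2. *)
Lemma exists_sqrt C : bnorm C <= 1 -> exists X : bop H,
  [/\ bnorm X <= 1, (1 - X) * (1 - X) = 1 - C, inM C -> inM X,
      radj C C -> radj X X & forall B, GRing.comm C B -> GRing.comm X B].
Proof.
move=> C1.
pose X := fix X n := if n is n'.+1 then half *: (C + X n' * X n') else 0.
have XE n : X n.+1 = half *: (C + X n * X n) by [].
(* The same iteration on scalars, with [C] replaced by the bound [1]: it stays in [0, 1] and its
   increments majorize those of [X]. *)
pose c := fix c n : R := if n is n'.+1 then (1 + c n' * c n') / 2 else 0.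
have c01 n : 0 <= c n <= 1 by elim: n => /= [|n /andP[]]; [rewrite lexx ler01 | nra].
have bhalf A : bnorm (half *: A) <= bnorm A / 2.
  by apply: (le_trans (bnormZ_le _ _)); rewrite rnorm_real ger0_norm ?invr_ge0// mulrC.
have Xc n : bnorm (X n) <= c n.
  elim: n => [|n IHn] /=; first by rewrite bnorm0.
  apply: (le_trans (bhalf _)); rewrite ler_wpM2r ?invr_ge0//.
  by apply: (le_trans (bnormD _ _)); rewrite lerD// bnormM_le.
have XS n : bnorm (X n.+1 - X n) <= c n.+1 - c n.
  elim: n => [|n IHn].
    rewrite /= subr0 mulr0 addr0; apply: (le_trans (bhalf _)).
    by rewrite mul0r addr0 subr0 ler_wpM2r ?invr_ge0.
  have -> : X n.+2 - X n.+1 =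
      half *: (X n.+1 * (X n.+1 - X n) + (X n.+1 - X n) * X n).
    rewrite -[LHS]/(half *: (C + X n.+1 * X n.+1) - half *: (C + X n * X n)).
    rewrite -scalerBr; congr (_ *: _).
    by rewrite mulrBr mulrBl addrA subrK opprD addrACA subrr add0r.
  apply: (le_trans (bhalf _)).
  have -> : c n.+2 - c n.+1 = (c n.+1 * (c n.+1 - c n) + (c n.+1 - c n) * c n) / 2.
    rewrite -[c n.+2 - c n.+1]/((1 + c n.+1 * c n.+1) / 2 - (1 + c n * c n) / 2).
    by move: (c n.+1) (c n) => u v; ring.
  rewrite ler_wpM2r ?invr_ge0//; apply: (le_trans (bnormD _ _)).
  by rewrite lerD// bnormM_le.
have [Y XY Y1] : exists2 Y : bop H, forall x, slim (fun n => X n x) (Y x) & bnorm Y <= 1.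
  by apply: (bop_limit_monotone (c := c)) => // n; case/andP: (c01 n).
have X1 n : bnorm (X n) <= 1 by apply: le_trans (Xc n) _; case/andP: (c01 n).
have XYS x : slim (fun n => X n.+1 x) (Y x) by apply: (slim_sub (f := S)) (XY x).
have YE : Y = half *: (C + Y * Y).
  apply: bopP => x; apply: slim_unique (XYS x) _.
  by apply/slimZ/slimD; [exact: slim_cst | exact: slim_bopM].
exists Y; split=> //.
(* The fixed point equation [2 Y = C + Y^2] is [(1 - Y)^2 = 1 - C]. *)
- have YY : Y + Y = C + Y * Y by rewrite -(half_half (C + Y * Y)) -YE.
  have -> : C = Y + Y - Y * Y by rewrite YY addrK.
  by rewrite mulrBl mul1r mulrBr mulr1 -addrA -opprD addrA.
- move=> MC; apply: (inM_slim hM) XY => n; elim: n => [|n IHn]; first exact: inM0.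
  by rewrite XE; apply/(inMZ hM)/(inMD hM) => //; exact: inMM.
- move=> CC; apply: radj_sa_slim XY _ => n; elim: n => [|n IHn].
    exact: radj0.
  by rewrite XE; apply: radjZ; apply: radjD => //; exact: radjM.
- move=> B CB; apply: comm_slim XY _ => n; elim: n => [|n IHn].
    exact/commr_sym/commr0.
  rewrite XE; apply/comm_scale/commr_sym/commrD; first exact: commr_sym.
  by apply: commrM; exact: commr_sym.
Qed.
(** The square of [|x - W^2 x|] is [|x|^2 - 2 |W x|^2 + |W^2 x|^2], and [|W^2 x| <= |W x|]. *)
Lemma bnorm_one_minus_sqr W : radj W W -> bnorm W <= 1 -> bnorm (1 - W * W) <= 1.
Proof.
move=> WW W1; apply: bnorm_le => // x; rewrite mul1r.
rewrite -(ler_pXn2r (n := 2)) ?nnegrE ?rnorm_ge0// -ripxx bopDE bopNE bop1E.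
rewrite ripBl !ripBr (ripC x ((W * W) x)) sa_sqr_norm// !ripxx.
have := rnorm_bop_le (W x) W1; rewrite mul1r -bopME.
by have := rnorm_ge0 ((W * W) x); nra.
Qed.

(* P is the limit of (1 - W^2)^(2n); even powers make the sequence Cauchy
   without any use of positivity. *)
Lemma kernel_projection W : radj W W -> bnorm W <= 1 -> exists P : bop H,
  [/\ inM W -> inM P, radj P P & P * P = P] /\
  [/\ W * P = 0, forall x, W x = 0 -> P x = x &
      forall B, GRing.comm W B -> GRing.comm P B].
Proof.
move=> WW W1; pose K := 1 - W * W.
have KK : radj K K by apply: radjB; [exact: radj1 | exact: radjM].
have K1 : bnorm K <= 1 by exact: bnorm_one_minus_sqr.
have KX1 n : bnorm (K ^+ n) <= 1 by rewrite -(expr1n _ n); exact: bnormX_le.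
pose S n := K ^+ n.*2.
have [P SP P1] : exists2 P : bop H, forall x, slim (fun n => S n x) (P x) & bnorm P <= 1.
  apply: bop_limit => [n|x e e0]; first exact: KX1.
  (* As [K] is self-adjoint, the square of [|S m x - S n x|] is [b (2m) - 2 b (m + n) + b (2n)]; it
     is small because [b] decreases towards its infimum. *)
  pose b n := rnorm ((K ^+ n) x) ^+ 2.
  have b_ge0 n : 0 <= b n by exact: sqr_ge0.
  have b_mono n k : b (n + k)%N <= b n.
    rewrite /b ler_sqr ?nnegrE ?rnorm_ge0// addnC exprD bopME.
    by rewrite -[leRHS]mul1r; exact: rnorm_bop_le.
  have ripK m n k : (m + n = k + k)%N -> rip ((K ^+ m) x) ((K ^+ n) x) = b k.
    move=> mn; rewrite -(radjX n KK) -bopME -exprD addnC mn exprD bopME.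
    by rewrite (radjX k KK) ripxx.
  have ib : has_inf (range b).
    by split; [exists (b 0%N); exists 0%N | exists 0 => _ [n _ <-]].
  have e20 : 0 < e ^+ 2 by rewrite exprn_gt0.
  have [_ [N _ <-] bN] := inf_adherent e20 ib.
  exists N => m n Nn nm; rewrite -(ltr_pXn2r (n := 2)) ?nnegrE ?rnorm_ge0 ?ltW//.
  rewrite -ripxx ripBl !ripBr (ripC ((S n) x) ((S m) x)) /S.
  rewrite (ripK m.*2 m.*2 m.*2)// (ripK n.*2 n.*2 n.*2)//.
  rewrite (ripK m.*2 n.*2 (m + n)%N) -?doubleD ?addnn//.
  have bm : inf (range b) <= b m.*2 by apply: ge_inf; [case: ib | exists m.*2].
  have bmn : b m.*2 <= b (m + n)%N.
    by rewrite -addnn -{2}(subnKC nm) addnA b_mono.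
  have bn : b n.*2 <= b N by rewrite -addnn -(subnKC (leq_trans Nn (leq_addr n n))) b_mono.
  by move: bN bm bmn bn; lra.
have KKP : K * K * P = P.
  apply: bopP => x; apply: slim_unique (slim_sub (f := succn) (fun n => leqnSn n) (SP x)).
  have := bop_slim (K * K) (SP x); congr (slim _ _); apply: funext => n.
  by rewrite -[LHS]/((K * K * S n) x) -expr2 -exprD.
(* With [V = W^2] and [y = P x], the equation [(1 - V)^2 y = y] gives [2 V y = V^2 y]. As [V] is a
   contraction, [V y = 0], and then [|W y|^2 = <V y, y> = 0]. *)
have WP : W * P = 0.
  apply: bopP => x; apply: rnorm_eq0; rewrite bopME; set y := P x.
  have : K (K y) = y by rewrite -bopME /y -bopME KKP.
  have : rnorm ((W * W) ((W * W) y)) <= 1 * rnorm ((W * W) y).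
    by apply: rnorm_bop_le; rewrite -(mul1r 1); exact: bnormM_le.
  set V := W * W => V1; rewrite !(bopDE, bopNE, bop1E) linearB -addrA -opprD.
  move=> /(congr1 (fun v => y - v)); rewrite subKr subrr addrA => /eqP.
  rewrite subr_eq0 => /eqP Vy.
  have : rnorm (V y) = 2^-1 * rnorm (V (V y)).
    by rewrite -Vy -rnorm_realZ ?invr_ge0// scalerDr half_half.
  have := sa_sqr_norm y WW; rewrite -/V => VE V2.
  have Vy0 : V y = 0 by apply: rnorm_eq0; have := rnorm_ge0 (V y); lra.
  by apply/eqP; rewrite -sqrf_eq0 -VE Vy0 /rip linear0l.
have PE x : W x = 0 -> P x = x.
  move=> Wx; apply: slim_unique (SP x) _; have KX n : (K ^+ n) x = x.
    elim: n => [|n IHn]; first by rewrite expr0.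
    by rewrite exprS bopME IHn bopDE bopNE bopME Wx linear0 subr0.
  by under eq_fun do rewrite KX; exact: slim_cst.
exists P; split; split=> //.
- move=> MW; apply: (inM_slim hM) SP => n; apply: (inMX hM).
  by apply: (inMB hM); [exact: inM1 | exact: (inMM hM)].
- by apply: radj_sa_slim SP _ => n; exact: radjX.
- by apply: bopP => x; rewrite bopME PE// -bopME WP.
- move=> B WB; apply: comm_slim SP _ => n; apply/commr_sym/commrX.
  by apply: commrB; [exact: commr1 | apply: commrM; exact: commr_sym].
Qed.
End Spectral.

(** * Neumann series and spectral projections *)

Section SpectralProjection.
Variables (R : realType) (H : hilbertSpace R).
Implicit Types (A B C S T P W Y Z D J : bop H) (x y : H) (a : R[i]).

(** Partial sums of the Neumann series, majorized by the geometric series of ratio [q]; they lie in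
    every von Neumann algebra containing [D], hence so does the limit. *)
Lemma neumann D (q : R) : bnorm D <= q -> q < 1 -> exists J : bop H,
  [/\ J * (1 - D) = 1, (1 - D) * J = 1, bnorm J <= (1 - q)^-1 &
      forall M, von_neumann_algebra M -> bmem M D -> bmem M J].
Proof.
move=> Dq q1; have q0 : 0 <= q by apply: le_trans Dq; exact: bnorm_ge0.
pose S := fix S n := if n is n'.+1 then 1 + D * S n' else 0.
have SE n : S n.+1 = 1 + D * S n by [].
pose c := fix c n : R := if n is n'.+1 then 1 + q * c n' else 0.
have cE n : c n.+1 = 1 + q * c n by [].
have cq n : c n <= (1 - q)^-1.
  elim: n => [|n IHn]; first by rewrite invr_ge0; lra.
  rewrite cE; apply: (@le_trans _ _ (1 + q * (1 - q)^-1)).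
    by rewrite lerD2l ler_wpM2l.
  have q1' : 1 - q != 0 by apply/eqP; lra.
  by rewrite le_eqVlt; apply/orP; left; apply/eqP; field.
have [J SJ Jq] : exists2 J : bop H, forall x, slim (fun n => S n x) (J x) &
    bnorm J <= (1 - q)^-1.
  apply: (bop_limit_monotone cq); first by rewrite bnorm0.
  elim=> [|n IHn].
    have [S0 c00] : S 0%N = 0 /\ c 0%N = 0 by [].
    by rewrite SE cE S0 c00 !(mulr0, addr0, subr0) bnorm1_le.
  rewrite (SE n.+1) (SE n) opprD addrACA subrr add0r -mulrBr -SE.
  have -> : c n.+2 - c n.+1 = q * (c n.+1 - c n).
    by rewrite (cE n.+1) {2}(cE n); move: (c n.+1) (c n) => u v; ring.
  exact: bnormM_le.
have JE : J = 1 + D * J.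
  apply: bopP => x; apply: slim_unique (slim_sub (f := succn) (fun n => leqnSn n) (SJ x)) _.
  by apply: slimD; [exact: slim_cst | exact: (bop_slim D)].
have DJ : GRing.comm J D.
  apply: comm_slim SJ _ => n; elim: n => [|n IHn]; first exact/commr_sym/commr0.
  rewrite SE; apply/commr_sym/commrD; first exact: commr1.
  by apply: commrM; [exact: commr_refl | exact: commr_sym].
have J1 : J - D * J = 1 by rewrite {1}JE addrK.
exists J; split=> //.
- by rewrite mulrBr mulr1 DJ.
- by rewrite mulrBl mul1r.
- move=> M hM MD; apply: (inM_slim hM) SJ; elim=> [|n IHn]; first exact: inM0.
  by rewrite SE; apply: (inMD hM); [exact: inM1 | exact: (inMM hM)].
Qed.

Lemma bnorm_radj A B : radj A B -> bnorm B <= bnorm A.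
Proof.
move=> AB; apply: bnorm_le => [|x]; first exact: bnorm_ge0.
have [->|/eqP] := eqVneq (B x) 0; first by rewrite rnorm0 mulr_ge0 ?bnorm_ge0 ?rnorm_ge0.
move=> /rnorm_gt0 Bx0; rewrite -(ler_pM2r Bx0) -expr2 -ripxx -AB.
apply: (le_trans (rip_le _ _)); have := rnorm_bop A (B x); have := rnorm_ge0 x; nra.
Qed.

Lemma rnorm_proj P x : radj P P -> P * P = P -> rnorm (P x) <= rnorm x.
Proof.
move=> PP P2; have [->|/eqP] := eqVneq (P x) 0; first by rewrite rnorm0 rnorm_ge0.
move=> /rnorm_gt0 Px0; rewrite -(ler_pM2r Px0) -expr2 -ripxx PP -bopME P2.
by rewrite rip_le.
Qed.

Lemma bnorm_proj P : radj P P -> P * P = P -> bnorm P <= 1.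
Proof. by move=> PP P2; apply: bnorm_le => // x; rewrite mul1r rnorm_proj. Qed.

Variable M : set (H -> H).
Hypothesis hM : von_neumann_algebra M.
Notation inM := (bmem M).

(* The spectral projection of N = c (d^2 - A^* A) for the half-line [0, oo): it
   is the projection onto the kernel of |N| - N. *)
Lemma spectral_projection A A' (d : R) x0 : inM A -> inM A' -> radj A A' ->
  rnorm (A x0) < d * rnorm x0 -> exists P : bop H,
  [/\ inM P, radj P P, P * P = P & P <> 0] /\
  (forall x, rnorm (A (P x)) <= d * rnorm (P x)) /\
  (forall B, GRing.comm (A' * A) B -> GRing.comm P B).
Proof.
move=> MA MA' AA' Ax0.
have x0_ge0 := rnorm_ge0 x0; have Ax0_ge0 := rnorm_ge0 (A x0).
have d0 : 0 < d by nra.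
(* This scaling makes [N] a contraction, as the square root requires. *)
pose c := (d ^+ 2 + bnorm (A' * A))^-1.
have c0 : 0 < c.
  by rewrite invr_gt0 ltr_wpDr ?bnorm_ge0 ?exprn_gt0.
pose N : bop H := c%:C *: ((d ^+ 2)%:C *: (1 : bop H) - A' * A).
have MN : inM N.
  by apply/(inMZ hM)/(inMB hM); [exact/(inMZ hM)/(inM1 hM) | exact: inMM].
have NN : radj N N.
  by apply: radjZ; apply: radjB; [apply: radjZ; exact: radj1 | apply: radjM => //; exact: radj_sym].
have ripN x : rip (N x) x = c * (d ^+ 2 * rnorm x ^+ 2 - rnorm (A x) ^+ 2).
  rewrite /N bopZE ripZl bopDE bopNE bopZE ripBl ripZl bop1E bopME.
  by rewrite (radj_sym AA') !ripxx.
have N1 : bnorm N <= 1.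
  apply: (le_trans (bnormZ_le _ _)); rewrite rnorm_real gtr0_norm//.
  apply: (@le_trans _ _ (c * c^-1)); last by rewrite mulfV ?gt_eqF.
  rewrite ler_pM2l// /c invrK; apply: (le_trans (bnormB _ _)); rewrite lerD2r.
  apply: (le_trans (bnormZ_le _ _)); rewrite rnorm_real ger0_norm ?sqr_ge0//.
  by rewrite ler_piMr ?sqr_ge0 ?bnorm1_le.
have [X [X1 XE MX XX XB]] := exists_sqrt hM (bnorm_one_minus_sqr NN N1).
have {}MX : inM X by apply/MX/(inMB hM); [exact: inM1 | exact: inMM].
have {}XX : radj X X by apply/XX/radjB; [exact: radj1 | exact: radjM].
(* [Y] plays the role of [|N|]: its square is [N^2], and it is nonnegative because [X] is a
   contraction. *)
pose Y := 1 - X.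
have {}XE : Y * Y = N * N by rewrite /Y XE opprB addrC subrK.
have YY : radj Y Y by apply: radjB; first exact: radj1.
have NY : GRing.comm Y N.
  apply/commr_sym/commrB; first exact: commr1.
  by apply/commr_sym/XB/commr_sym/commrB; [exact: commr1 | exact: commrM].
have Y_ge0 x : 0 <= rip (Y x) x.
  rewrite /Y bopDE bopNE bop1E ripBl ripxx.
  have := rip_le (X x) x; have := rnorm_bop_le x X1; have := rnorm_ge0 x; nra.
(* [|Y| <= 2] and [|N| <= 1], so division by 3 yields a contraction. *)
pose W : bop H := (3^-1 : R)%:C *: (Y - N).
have W1 : bnorm W <= 1.
  apply: (le_trans (bnormZ_le _ _)); rewrite rnorm_real ger0_norm ?invr_ge0//.
  have Y2 : bnorm Y <= 1 + 1 by apply: (le_trans (bnormB _ _)); rewrite lerD ?bnorm1_le.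
  by have := bnormB Y N; lra.
have WW : radj W W by apply: radjZ; exact: radjB.
have WE x : W x = 0 -> Y x = N x.
  move=> /(congr1 (fun v => 3%:C *: v)); rewrite /W bopZE scalerA -rmorphM.
  rewrite mulfV ?pnatr_eq0// scale1r scaler0 bopDE bopNE => /eqP.
  by rewrite subr_eq0 => /eqP.
have [P [[MP PP P2] [WP PE PB]]] := kernel_projection hM WW W1.
exists P; split.
  split=> //.
    by apply/MP/(inMZ hM)/(inMB hM) => //; apply: (inMB hM) => //; exact: inM1.
  (* [(Y - N) (Y + N) = 0] puts the range of [Y + N] in the kernel of [W], where [P] is the
     identity. If [P = 0] then [Y = - N], which is impossible since [<N x0, x0>] is positive. *)
  move=> P0; have YN : Y + N = 0.
    apply: bopP => x; rewrite -[RHS]/((0 : bop H) ((Y + N) x)) -P0 PE//.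
    rewrite /W bopZE -bopME mulrBl (mulrDr Y Y N) (mulrDr N Y N) XE NY.
    by rewrite (addrC (N * Y) (N * N)) subrr bop0E scaler0.
  have := Y_ge0 x0; have -> : Y = - N by apply/eqP; rewrite -addr_eq0 YN.
  rewrite bopNE ripNl ripN; have : rnorm (A x0) ^+ 2 < d ^+ 2 * rnorm x0 ^+ 2.
    by rewrite -exprMn; move: Ax0_ge0 Ax0; set u := rnorm (A x0); set v := d * _; nra.
  by move=> h1; rewrite oppr_ge0 pmulr_rle0//; lra.
split=> [x|B AB].
  (* On the range of [P] one has [N = Y >= 0], and [<N y, y> >= 0] says exactly [|A y| <= d |y|]. *)
  have := Y_ge0 (P x); rewrite WE; last by rewrite -bopME WP.
  rewrite ripN pmulr_rge0// subr_ge0 -exprMn ler_pXn2r ?nnegrE ?rnorm_ge0//.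
  by rewrite mulr_ge0 ?rnorm_ge0 ?ltW.
apply: PB; apply: comm_scale; have NB : GRing.comm N B.
  apply: comm_scale; apply/commr_sym/commrB; last exact: commr_sym.
  by apply/commr_sym/comm_scale/commr_sym/commr1.
apply/commr_sym/commrB; last exact: commr_sym.
apply/commrB; first exact: commr1.
apply/commr_sym/XB/commr_sym/commrB; first exact: commr1.
by apply: commrM; exact: commr_sym.
Qed.

End SpectralProjection.

(** * Projections in ideals and norm bounds from unitary invariance *)

Section Ideal.
Variables (R : realType) (H : hilbertSpace R) (M I : set (H -> H)).
Hypothesis hM : von_neumann_algebra M.
Hypothesis hI : ideal M I.
Implicit Types (A B C S T P E F W X Y Z D J U V : bop H) (x y : H) (a : R[i]).
Notation inM := (bmem M).
Notation inI := (bmem I).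

(** A substitute for polar decomposition. Let [b = Y' Y / |Y|^2] and let [P] be a spectral
    projection of [b] near 1; [b] is invertible on its range, so [P] is a left multiple of [Y].
    Hence [P] lies in any ideal containing [Y], and [P Q = P] whenever [Y Q = Y]. *)
Lemma factor_projection Y : inM Y -> Y <> 0 -> exists P Z : bop H,
  [/\ inM P, radj P P, P * P = P & P <> 0] /\
  [/\ inM Z, Z * Y = P & bnorm Z * bnorm Y <= 2].
Proof.
move=> MY Y0; have [Y' MY' YY'] := inM_adj hM MY.
set y := bnorm Y; have y0 : 0 < y.
  by rewrite ltNge; apply/negP => /bnorm_eq0.
pose b : bop H := (y ^- 2)%:C *: (Y' * Y).
have y20 : 0 <= y ^- 2 by rewrite invr_ge0 sqr_ge0.
have Mb : inM b by apply/(inMZ hM)/(inMM hM).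
have bb : radj b b by apply: radjZ; apply: radjM => //; exact: radj_sym.
have MA : inM (1 - b) by apply: (inMB hM) => //; exact: inM1.
have AA : radj (1 - b) (1 - b) by apply: radjB; first exact: radj1.
(* A vector nearly attaining the norm of [Y]. With [t = |Y x0| / y], [|(1 - b) x0|^2 <= |x0|^2 - t^2
   < (19/100) |x0|^2], which is below a quarter of [|x0|^2]. *)
have [x0 Yx0] : exists x0, 9 / 10 * y * rnorm x0 < rnorm (Y x0).
  apply: contrapT => /forallNP Yle; suff : y <= 9 / 10 * y by lra.
  apply: bnorm_le => [|x]; first by lra.
  by rewrite leNgt; apply/negP/Yle.
have x0_ge0 := rnorm_ge0 x0.
have Ax0 : rnorm ((1 - b) x0) < 2^-1 * rnorm x0.
  have bx0 : rnorm (b x0) <= rnorm (Y x0) / y.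
    rewrite /b bopZE rnorm_realZ// bopME.
    have := rnorm_bop_le (Y x0) (bnorm_radj YY').
    rewrite -/y => h; rewrite -(ler_pM2l (exprn_gt0 2 y0)) mulrA mulfV ?gt_eqF ?exprn_gt0//.
    by rewrite mul1r mulrC [X in _ <= X](_ : _ = y * rnorm (Y x0))//; field; rewrite gt_eqF.
  have rb : rip (b x0) x0 = (rnorm (Y x0) / y) ^+ 2.
    rewrite /b bopZE ripZl bopME (radj_sym YY') ripxx.
    by rewrite expr_div_n mulrC.
  have : 9 / 10 * rnorm x0 < rnorm (Y x0) / y by rewrite ltr_pdivlMr// mulrAC.
  move: bx0 rb; set t := rnorm (Y x0) / y => bx0 rb xt.
  rewrite -(ltr_pXn2r (n := 2)) ?nnegrE ?rnorm_ge0 ?mulr_ge0 ?invr_ge0//.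
  rewrite -ripxx bopDE bopNE bop1E ripBl !ripBr (ripC x0 (b x0)) rb !ripxx.
  by have := rnorm_ge0 (b x0); nra.
have [P [[MP PP P2 P0] [AP PB]]] := spectral_projection hM MA MA AA Ax0.
have Pb : GRing.comm P b.
  apply: PB; have c1 : GRing.comm b (1 - b) by apply: commrB => //; exact: commr1.
  by apply/commr_sym/commrM.
(* So [1 - (1 - b) P] has an inverse [J] of norm at most 2, and [J (b P) = P] because
   [b P = (1 - (1 - b) P) P]. *)
have Dh : bnorm ((1 - b) * P) <= 2^-1.
  apply: bnorm_le => [|x]; first by rewrite invr_ge0.
  by apply: (le_trans (AP x)); rewrite ler_wpM2l ?invr_ge0 ?rnorm_proj.
have [J [J1 _ Jn MJ]] := neumann Dh ltac:(lra).
have {}MJ : inM J by apply: (MJ _ hM); exact: inMM.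
have {}Jn : bnorm J <= 2.
  by apply: (le_trans Jn); rewrite -ler_pV2 ?inE ?unitfE ?invr_gt0 ?invr_eq0 ?invrK; lra.
exists P, ((y ^- 2)%:C *: (J * P * Y')); split=> //; split.
- by apply/(inMZ hM)/(inMM hM) => //; exact: inMM.
- have -> : (y ^- 2)%:C *: (J * P * Y') * Y = J * (P * b).
    by rewrite /b -bop_scaleAr -bop_scaleAl -!bop_scaleAr !mulrA.
  rewrite Pb; have -> : b * P = (1 - (1 - b) * P) * P.
    by rewrite mulrBl mul1r -mulrA P2 mulrBl mul1r opprB addrC subrK.
  by rewrite mulrA J1 mul1r.
- have -> : 2 = y ^- 2 * (2 * y) * y by field; rewrite gt_eqF.
  rewrite ler_pM2r//; apply: (le_trans (bnormZ_le _ _)).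
  rewrite rnorm_real ger0_norm// ler_wpM2l//; apply: bnormM_le; last exact: bnorm_radj.
  by rewrite -(mulr1 2); apply: bnormM_le => //; exact: bnorm_proj.
Qed.

Variable Phi : (H -> H) -> R.
Hypothesis hPhi : norm_on I Phi.
Hypothesis hinv : unitarily_invariant M I Phi.

Lemma inI_M X : inI X -> inM X. Proof. exact: (ideal_sub hI). Qed.
Lemma inID X Y : inI X -> inI Y -> inI (X + Y). Proof. exact: (ideal_add hI). Qed.
Lemma inIZ a X : inI X -> inI (a *: X). Proof. exact: (ideal_scale hI). Qed.
Lemma inIMl A X : inM A -> inI X -> inI (A * X). Proof. exact: (ideal_mull hI). Qed.
Lemma inIMr X A : inI X -> inM A -> inI (X * A). Proof. exact: (ideal_mulr hI). Qed.

Definition PhiB (X : bop H) := Phi X.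

Lemma PhiB_ge0 X : inI X -> 0 <= PhiB X. Proof. exact: (norm_on_ge0 hPhi). Qed.
Lemma PhiBZ a X : inI X -> PhiB (a *: X) = rnorm a * PhiB X.
Proof. exact: (norm_on_scale hPhi). Qed.
Lemma PhiBD X Y : inI X -> inI Y -> PhiB (X + Y) <= PhiB X + PhiB Y.
Proof. exact: (norm_on_triangle hPhi). Qed.

Lemma bunitary U V : radj U V -> V * U = 1 -> U * V = 1 -> unitary U.
Proof.
move=> UV VU UV1; exists V; split.
- by apply: radj_adjoint => //; exact: bop_linear.
- by apply: funext => x; rewrite -[LHS]/((V * U) x) VU.
- by apply: funext => x; rewrite -[LHS]/((U * V) x) UV1.
Qed.

Lemma PhiB_unitary X U V : inI X -> inM U -> unitary U -> inM V -> unitary V ->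
  PhiB (U * X * V) = PhiB X.
Proof. exact: hinv. Qed.

Lemma unitary1 : unitary (1 : bop H).
Proof. by apply: (bunitary (V := 1)); rewrite ?mulr1. Qed.

(* A self-adjoint contraction B is the average of the unitaries B +- i sqrt(1 - B^2). *)
Lemma sa_contraction_unitaries B : inM B -> radj B B -> bnorm B <= 1 ->
  exists U V : bop H,
  [/\ inM U, unitary U, inM V, unitary V & B = (2^-1 : R)%:C *: (U + V)].
Proof.
move=> MB BB B1; have B21 : bnorm (B * B) <= 1 by rewrite -(mul1r 1); exact: bnormM_le.
have [X [_ XE MX XX XB]] := exists_sqrt hM B21.
have {}MX : inM X by apply/MX/(inMM hM).
have {}XX : radj X X by apply/XX/radjM.
pose Y := 1 - X; rewrite -/Y in XE.
have MY : inM Y by apply: (inMB hM) => //; exact: inM1.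
have YY : radj Y Y by apply: radjB; first exact: radj1.
have BY : GRing.comm B Y.
  by apply: commrB; [exact: commr1 | apply/commr_sym/XB/commr_sym/commrM].
clearbody Y.
have UV : radj (B + 'i *: Y) (B - 'i *: Y) by apply: radjD => //; exact: radj_i.
have iY : ('i *: Y) * ('i *: Y) = - (Y * Y).
  by rewrite -bop_scaleAl -bop_scaleAr scalerA -expr2 sqr_i scaleN1r.
have BiY : B * ('i *: Y) = ('i *: Y) * B by rewrite -bop_scaleAr BY bop_scaleAl.
have VU : (B - 'i *: Y) * (B + 'i *: Y) = 1.
  by rewrite mulrBl !mulrDr iY BiY opprD opprK addrA addrK XE addrC subrK.
have UV1 : (B + 'i *: Y) * (B - 'i *: Y) = 1.
  by rewrite mulrDl !mulrBr iY opprK BiY addrA subrK XE addrC subrK.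
pose U : bop H := B + 'i *: Y; pose V : bop H := B - 'i *: Y.
exists U, V; split.
- by apply: (inMD hM) => //; exact: inMZ.
- exact: bunitary UV VU UV1.
- by apply: (inMB hM) => //; exact: inMZ.
- exact: bunitary (radj_sym UV) UV1 VU.
- by rewrite addrACA subrr addr0 scalerDr half_half.
Qed.

(** [A = c (A1 + i A2)] with self-adjoint contractions [A1] and [A2], each an average of two
    unitaries; the factor 2 counts these two parts. It is applied to the norm of left and of right
    multiples of a fixed [X]. *)
Lemma seminorm_le_unitaries (g : bop H -> R) (p c : R) A :
  (forall U, inM U -> unitary U -> g U <= p) ->
  (forall S T, inM S -> inM T -> g (S + T) <= g S + g T) ->
  (forall a S, inM S -> g (a *: S) = rnorm a * g S) ->
  inM A -> bnorm A <= c -> g A <= 2 * c * p.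
Proof.
move=> gU gD gZ MA Ac; have [c0|c0] := leP c 0.
  have A0 := bnorm_eq0 (le_trans Ac c0).
  have c00 : c = 0 by apply/eqP; rewrite eq_le c0 (le_trans (bnorm_ge0 A) Ac).
  by rewrite A0 c00 mulr0 mul0r -(scale0r (0 : bop H)) gZ ?rnorm0 ?mul0r//; exact: inM0.
have gsa B : inM B -> radj B B -> bnorm B <= 1 -> g B <= p.
  move=> MB BB B1; have [U [V [MU uU MV uV ->]]] := sa_contraction_unitaries MB BB B1.
  rewrite gZ; last exact: inMD.
  rewrite rnorm_real ger0_norm ?invr_ge0//.
  by have := gD _ _ MU MV; have := gU _ MU uU; have := gU _ MV uV; lra.
have [A' MA' AA'] := inM_adj hM MA.
have A'c : bnorm A' <= c := le_trans (bnorm_radj AA') Ac.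
pose r : R := (2 * c)^-1; have r0 : 0 <= r by rewrite invr_ge0; lra.
have norm1 B : bnorm B <= c + c -> bnorm (r%:C *: B) <= 1.
  move=> Bc; apply: (le_trans (bnormZ_le _ _)); rewrite rnorm_real ger0_norm//.
  by rewrite /r mulrC ler_pdivrMr; lra.
have A'A := radj_sym AA'.
pose A1 : bop H := r%:C *: (A + A').
pose A2 : bop H := r%:C *: ('i *: A' - 'i *: A).
have g1 : g A1 <= p.
  apply: gsa; first by apply/(inMZ hM)/(inMD hM).
    by apply: radjZ; rewrite {2}addrC; exact: radjD.
  by apply: norm1; apply: (le_trans (bnormD _ _)); rewrite lerD.
have ibn B : bnorm B <= c -> bnorm ('i *: B) <= c.
  by move=> Bc; apply: (le_trans (bnormZ_le _ _)); rewrite rnorm_i mul1r.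
have g2 : g A2 <= p.
  apply: gsa; first by apply/(inMZ hM)/(inMB hM); exact: inMZ.
    apply: radjZ; rewrite {2}addrC -{2}(opprK ('i *: A')); apply: radjB; exact: radj_i.
  by apply: norm1; apply: (le_trans (bnormB _ _)); rewrite lerD ?ibn.
have MA1 : inM A1 by apply/(inMZ hM)/(inMD hM).
have MA2 : inM A2 by apply/(inMZ hM)/(inMB hM); exact: inMZ.
have iA2 : 'i *: A2 = r%:C *: (A - A').
  rewrite /A2 scalerA mulrC -scalerA scalerBr !scalerA -expr2 sqr_i.
  by rewrite !scaleN1r opprK addrC.
have -> : A = c%:C *: (A1 + 'i *: A2).
  rewrite iA2 -scalerDr addrACA subrr addr0 scalerA -rmorphM scalerDr.
  have -> : c * r = 2^-1 by rewrite /r; field; rewrite gt_eqF.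
  by rewrite half_half.
have MiA2 : inM ('i *: A2) by exact: inMZ.
rewrite gZ; last exact: inMD.
rewrite rnorm_real gtr0_norm// [2 * c]mulrC -mulrA ler_pM2l//.
by have := gD _ _ MA1 MiA2; rewrite (gZ 'i A2)// rnorm_i mul1r; lra.
Qed.

Lemma PhiB_Ml A X (c : R) : inM A -> bnorm A <= c -> inI X ->
  PhiB (A * X) <= 2 * c * PhiB X.
Proof.
move=> MA Ac IX; apply: (seminorm_le_unitaries (g := fun A => PhiB (A * X))) MA Ac.
- move=> U MU uU; rewrite -(mulr1 (U * X)) PhiB_unitary//; first exact: inM1.
  exact: unitary1.
- by move=> S T MS MT; rewrite mulrDl PhiBD//; exact: inIMl.
- by move=> a S MS; rewrite -bop_scaleAl PhiBZ//; exact: inIMl.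
Qed.

Lemma PhiB_Mr A X (c : R) : inM A -> bnorm A <= c -> inI X ->
  PhiB (X * A) <= 2 * c * PhiB X.
Proof.
move=> MA Ac IX; apply: (seminorm_le_unitaries (g := fun A => PhiB (X * A))) MA Ac.
- move=> U MU uU; rewrite -(mul1r X) PhiB_unitary//; first exact: inM1.
  exact: unitary1.
- by move=> S T MS MT; rewrite mulrDr PhiBD//; exact: inIMr.
- by move=> a S MS; rewrite -bop_scaleAr PhiBZ//; exact: inIMr.
Qed.

End Ideal.

(** The minimum over the compact square of side [2 r], which contains the disc, is attained and
    hence positive. This serves to bound resolvents. *)
Lemma lipschitz_pos_bound (R : realType) (f : R[i] -> R) (L r : R) :
  (forall z w, `|f z - f w| <= L * rnorm (z - w)) -> (forall z, 0 < f z) ->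
  0 <= r -> exists2 c, 0 < c & forall z, rnorm z <= r -> c <= f z.
Proof.
move=> fL f0 r0; pose g (p : R * R) := f (p.1 +i* p.2).
have gc : continuous g.
  move=> p; apply/cvgrPdist_lt => e e0.
  have L0 : 0 <= L.
    by have := fL 1 0; rewrite subr0 rnorm1 mulr1; apply: le_trans.
  have d0 : 0 < e / (2 * (L + 1)) by apply: divr_gt0; lra.
  pose d := e / (2 * (L + 1)); exists (ball p.1 d, ball p.2 d) => /=.
    by split; exact: nbhsx_ballx.
  case=> q1 q2 [] /=; rewrite -!ball_normE /= !ltr_pdivlMr; last 2 first; try lra.
  move=> pq1 pq2; apply: (le_lt_trans (fL _ _)).
  have -> : (p.1 +i* p.2) - (q1 +i* q2) = (p.1 - q1)%:C + 'i * (p.2 - q2)%:C.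
    by apply/eqP; rewrite eq_complex /=; apply/andP; split; apply/eqP; ring.
  have := rnormD (p.1 - q1)%:C ('i * (p.2 - q2)%:C).
  rewrite rnormM rnorm_i mul1r !rnorm_real.
  set u := rnorm _ => u0; have : 0 <= u by exact: rnorm_ge0.
  nra.
have c : compact (`[-r, r]%classic `*` `[-r, r]%classic : set (R * R)).
  by apply: compact_setX; exact: segment_compact.
have ne : (`[-r, r]%classic `*` `[-r, r]%classic : set (R * R)) !=set0.
  by exists (0, 0); split; rewrite /= in_itv /=; lra.
have [p _ pm] := compact_EVT_min ne c (continuous_subspaceT gc).
exists (g p); first exact: f0.
move=> z zr; have -> : f z = g (complex.Re z, complex.Im z) by case: z {zr}.
apply: pm; rewrite inE; split; rewrite /= in_itv /=.
  by have := rnorm_Re z; rewrite ler_norml; lra.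
have := rnorm_Re (- 'i * z); rewrite rnormM rnormN rnorm_i mul1r ler_norml.
have -> : complex.Re (- 'i * z) = complex.Im z by case: z {zr} => a b /=; ring.
by lra.
Qed.

(** * Invertibility and resolvents *)

Section Resolvent.
Variables (R : realType) (H : hilbertSpace R).
Implicit Types (A B C S T P E F W X Y Z D J U V G : bop H) (x y : H) (a z w : R[i]).

Notation one := (1 : bop H).

Definition binv A := exists S, S * A = 1 /\ A * S = 1.

Lemma spectrumE T z : spectrum T z <-> ~ binv (T - z *: one).
Proof.
split=> h [S]; [case=> ST TS | case=> Sb ST TS]; apply: h.
  exists S; split; first exact: bop_bounded.
    by apply: funext => x; rewrite -[LHS]/((S * (T - z *: one)) x) ST.
  by apply: funext => x; rewrite -[LHS]/(((T - z *: one) * S) x) TS.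
exists (mkbop Sb); split; apply: bopP => x.
  by rewrite -[RHS]/(idfun x) -ST.
by rewrite -[RHS]/(idfun x) -TS.
Qed.

Lemma binv1 : binv 1. Proof. by exists 1; rewrite mulr1. Qed.

Lemma binvM A B : binv A -> binv B -> binv (A * B).
Proof.
move=> [S [SA AS]] [T [TB BT]]; exists (T * S); split.
  by rewrite mulrA -(mulrA T) SA mulr1.
by rewrite mulrA -(mulrA A) BT mulr1.
Qed.

Lemma binvZ a A : a != 0 -> binv A -> binv (a *: A).
Proof.
move=> a0 [S [SA AS]]; exists (a^-1 *: S).
by rewrite -!bop_scaleAl -!bop_scaleAr !scalerA SA AS mulVf// mulfV// scale1r.
Qed.

Lemma binv_perturb A S D (K d : R) : S * A = 1 -> A * S = 1 ->
  bnorm S <= K -> bnorm D <= d -> K * d < 1 -> binv (A - D).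
Proof.
move=> SA AS SK Dd Kd; have -> : A - D = A * (1 - S * D).
  by rewrite mulrBr mulr1 mulrA AS mul1r.
apply: binvM; first by exists S.
by have [J [J1 J2 _ _]] := neumann (bnormM_le SK Dd) Kd; exists J.
Qed.

Lemma bop_exprZ a A n : (a *: A) ^+ n = a ^+ n *: A ^+ n.
Proof.
elim: n => [|n IHn]; first by rewrite !expr0 scale1r.
by rewrite !exprS IHn -bop_scaleAl -bop_scaleAr scalerA.
Qed.

Lemma norm_half_sum (A B : bop H) (c : R) : bnorm A <= c -> bnorm B <= c ->
  bnorm ((2^-1)%:C *: (A + B)) <= c.
Proof.
move=> Ac Bc; apply: (le_trans (bnormZ_le _ _)); rewrite rnorm_real ger0_norm ?invr_ge0//.
by have := bnormD A B; lra.
Qed.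

(** * Powers of an operator without nonzero spectrum *)

Section QuasiNilpotent.
Variables (G : bop H) (x0 : H).
Hypothesis x0N0 : x0 <> 0.
Hypothesis Ginv : forall z, z != 0 -> binv (G - z *: one).

Lemma binv_one_minus w : binv (1 - w *: G).
Proof.
have [->|w0] := eqVneq w 0; first by rewrite scale0r subr0; exact: binv1.
have -> : 1 - w *: G = (- w) *: (G - w^-1 *: one).
  by rewrite scalerBr scalerA mulNr mulfV// !scaleNr scale1r opprK addrC.
by apply: binvZ; [rewrite oppr_eq0 | apply: Ginv; rewrite invr_eq0].
Qed.

(** By the identity [Rs w - Rs w' = (w - w') Rs w G Rs w'], the function [1 / |Rs w|] is Lipschitz
    with constant [|G|]. It is positive, hence bounded below on the disc; so [|Rs w|] is bounded
    there and the same identity makes [Rs] Lipschitz. *)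
Lemma resolvent_bound (r : R) : 0 <= r -> exists (Rs : R[i] -> bop H) (L : R),
  [/\ 0 <= L, forall w, Rs w * (1 - w *: G) = 1 /\ (1 - w *: G) * Rs w = 1 &
      forall w w', rnorm w <= r -> rnorm w' <= r ->
        bnorm (Rs w - Rs w') <= L * rnorm (w - w')].
Proof.
move=> r0; have [Rs RsP] := choice binv_one_minus.
pose n w := bnorm (Rs w).
have n0 w : 0 < n w.
  rewrite ltNge; apply/negP => /bnorm_eq0 R0; apply: x0N0.
  by have [_ /(congr1 (fun A : bop H => A x0))] := RsP w; rewrite R0 mulr0 => /esym.
have diff w w' : bnorm (Rs w - Rs w') <= bnorm G * n w * n w' * rnorm (w - w').
  have -> : Rs w - Rs w' = (w - w') *: (Rs w * G * Rs w').
    have [_ w'E] := RsP w'; have [wE _] := RsP w.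
    have : Rs w * ((1 - w' *: G) - (1 - w *: G)) * Rs w' = Rs w - Rs w'.
      by rewrite mulrBr mulrBl -mulrA w'E wE mulr1 mul1r.
    move <-; rewrite opprB addrC -addrA (addrA (- 1)) addNr add0r.
    by rewrite -scalerBl -bop_scaleAr -bop_scaleAl.
  apply: (le_trans (bnormZ_le _ _)); rewrite mulrC ler_wpM2r ?rnorm_ge0//.
  by rewrite [bnorm G * _]mulrC; apply: bnormM_le => //; exact: bnormM_le.
have distn w w' : n w - n w' <= bnorm (Rs w - Rs w').
  by rewrite /n lerBlDr -{1}(subrK (Rs w') (Rs w)) bnormD.
have lip z w : `|(n z)^-1 - (n w)^-1| <= bnorm G * rnorm (z - w).
  have nn : 0 < n z * n w by rewrite mulr_gt0.
  have -> : (n z)^-1 - (n w)^-1 = (n w - n z) / (n z * n w).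
    by field; rewrite !gt_eqF.
  rewrite normrM (gtr0_norm (x := _^-1)) ?invr_gt0// ler_pdivrMr//.
  have := distn z w; have := distn w z; have := diff z w; have := diff w z.
  rewrite (rnormBC w z) ler_norml => h1 h2 h3 h4; apply/andP; split.
    by apply: le_trans (_ : - bnorm (Rs z - Rs w) <= _); [nra | lra].
  by apply: le_trans h3 (le_trans h1 _); nra.
have [|c c0 cn] := lipschitz_pos_bound lip _ r0; first by move=> z; rewrite invr_gt0.
exists Rs, (bnorm G * c^-1 * c^-1); split=> //.
  by rewrite !mulr_ge0 ?bnorm_ge0 ?invr_ge0// ltW.
have nc w : rnorm w <= r -> n w <= c^-1.
  by move=> /cn; rewrite -[n w]invrK lef_pV2 ?posrE ?invr_gt0// invrK.
move=> w w' wr w'r; apply: (le_trans (diff _ _)); rewrite ler_wpM2r ?rnorm_ge0//.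
rewrite -!mulrA ler_wpM2l ?bnorm_ge0// ler_pM ?(ltW (n0 _))// nc//.
Qed.

(** Iterated square roots of -1: replacing [w] by [w * zeta k] changes the sign of [(w G)^(2^k)] and
    keeps [|w|]. *)
Fixpoint zeta (k : nat) : R[i] := if k is k'.+1 then sqrtc (zeta k') else -1.

Lemma zetaX k : zeta k ^+ (2 ^ k) = -1.
Proof. by elim: k => [|k IHk]; rewrite ?expr1// expnS exprM /= sqr_sqrtc. Qed.

Lemma rnorm_zeta k : rnorm (zeta k) = 1.
Proof.
elim: k => [|k IHk]; first by rewrite rnormN rnorm1.
have : rnorm (zeta k.+1) ^+ 2 = 1 by rewrite expr2 -rnormM -expr2 sqr_sqrtc.
by move=> /eqP; rewrite sqrf_eq1 => /orP[/eqP//|/eqP h]; have := rnorm_ge0 (zeta k.+1); lra.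
Qed.

Let C (k : nat) (w : R[i]) : bop H := (w *: G) ^+ (2 ^ k).

Lemma CS k w : C k.+1 w = C k w * C k w.
Proof. by rewrite /C expnS mulnC exprM expr2. Qed.

Lemma C_zeta k w : C k (w * zeta k) = - C k w.
Proof. by rewrite /C !bop_exprZ exprMn zetaX mulrN1 scaleNr. Qed.

(* E_0 is the inverse of 1 - w G and E_(k+1) w = (E_k w + E_k (w zeta_k)) / 2;
   averaging preserves the Lipschitz constant. *)
Lemma averaged_resolvent (r : R) : 0 <= r -> exists (E : nat -> R[i] -> bop H) (L : R),
  [/\ 0 <= L, forall k w, E k w * (1 - C k w) = 1 /\ (1 - C k w) * E k w = 1 &
      forall k w w', rnorm w <= r -> rnorm w' <= r ->
        bnorm (E k w - E k w') <= L * rnorm (w - w')].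
Proof.
move=> r0; have [Rs [L [L0 RsP RsL]]] := resolvent_bound r0.
pose E := fix E k w : bop H :=
  if k is k'.+1 then (2^-1)%:C *: (E k' w + E k' (w * zeta k')) else Rs w.
have ES k w : E k.+1 w = (2^-1)%:C *: (E k w + E k (w * zeta k)) by [].
exists E, L; split=> //.
  elim=> [|k IHk] w; first by rewrite /C expr1; exact: RsP.
  have [E1 E2] := IHk w; have [E1' E2'] := IHk (w * zeta k).
  rewrite C_zeta opprK in E1' E2'; rewrite ES CS; set K := C k w in E1 E2 E1' E2' *.
  (* The inverse of [1 - K^2] is the average of the inverses of [1 - K] and [1 + K]. *)
  have K1 : 1 - K * K = (1 - K) * (1 + K).
    by rewrite mulrBl mul1r mulrDr mulr1 opprD addrA addrK.
  have K2 : 1 - K * K = (1 + K) * (1 - K).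
    by rewrite mulrDl mul1r mulrBr mulr1 addrA subrK.
  have sum2 : (1 + K) + (1 - K) = 1 + 1 by rewrite addrACA subrr addr0.
  split.
    rewrite -bop_scaleAl mulrDl {1}K1 K2 !mulrA E1 E1' !mul1r sum2 scalerDr.
    exact: half_half.
  rewrite -bop_scaleAr mulrDr {1}K2 K1 -!mulrA E2 E2' !mulr1 sum2 scalerDr.
  exact: half_half.
elim=> [|k IHk] w w' wr w'r; first exact: RsL.
rewrite !ES -scalerBr opprD addrACA; apply: norm_half_sum; first exact: IHk.
have := IHk (w * zeta k) (w' * zeta k).
by rewrite -mulrBl !rnormM rnorm_zeta !mulr1; exact.
Qed.

(** A continuity argument in place of the spectral radius formula. The Lipschitz constant [L] of the
    inverses [E k] of [1 - C k] does not depend on [k], so smallness of some [C k t] passes from [t]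
    to all points within a fixed distance, and finitely many such moves lead from 0 to [r]. *)
Lemma quasinilpotent (r : R) : 0 < r -> exists n, bnorm ((r%:C *: G) ^+ n) <= 2^-1.
Proof.
move=> r0; have [E [L [L0 EP EL]]] := averaged_resolvent (ltW r0).
pose S (t : R) := exists k, bnorm (C k t%:C) <= 2^-1.
(* Squaring twice improves 1/2 to 1/16, which leaves room for the Lipschitz error 1/8. *)
have step t t' : 0 <= t -> t <= r -> 0 <= t' -> t' <= r -> L * `|t - t'| <= 1 / 8 ->
    S t -> S t'.
  move=> t0 tr t'0 t'r Ltt' [k Ck]; exists k.+2.
  have C16 : bnorm (C k.+2 t%:C) <= 16^-1.
    have -> : 16^-1 = (2^-1 * 2^-1) * (2^-1 * 2^-1) :> R by field.
    by rewrite !CS; do 2! apply: bnormM_le.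
  have [E1 _] := EP k.+2 t'%:C; have [_ E2'] := EP k.+2 t%:C.
  have [_ E2] := EP k.+2 t'%:C.
  (* If [e = E y] then [|e - y| = |C e| <= (|e - y| + |y|) / 16], whence 1/15. *)
  have CE y : rnorm ((E k.+2 t%:C) y - y) <= 1 / 15 * rnorm y.
    have : (1 - C k.+2 t%:C) ((E k.+2 t%:C) y) = y by rewrite -bopME E2'.
    rewrite bopDE bopNE bop1E; set e := (E _ _) y => ey.
    have -> : e - y = C k.+2 t%:C e by rewrite -{1}ey opprB addrC subrK.
    have := rnorm_bop_le e C16; have := rnormD (e - y) y; rewrite subrK.
    have -> : e - y = C k.+2 t%:C e by rewrite -{1}ey opprB addrC subrK.
    lra.
  have E8 : bnorm (E k.+2 t'%:C - E k.+2 t%:C) <= 1 / 8.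
    apply: (le_trans (EL _ _ _ _ _)); rewrite ?rnorm_real ?ger0_norm//.
    by rewrite -rmorphB rnorm_real distrC.
  apply: bnorm_le => [|y]; first by rewrite invr_ge0.
  set K := C k.+2 t'%:C in E1 E2 *; set F := E k.+2 t'%:C in E1 E2 E8 *.
  (* [|F - 1| <= 1/15 + 1/8 <= 1/4], so this identity gives [|K y| <= (|y| + |K y|) / 4] and thus
     [|K y| <= |y| / 3]. *)
  have KF : K = (F - 1) * (1 - K).
    by rewrite mulrBl E1 mul1r opprB addrC subrK.
  have : rnorm (K y) <= rnorm ((F - 1) ((1 - K) y)) by rewrite {1}KF bopME.
  set v := (1 - K) y.
  have vle : rnorm v <= rnorm y + rnorm (K y) by rewrite /v bopDE bopNE bop1E rnormB.
  have : rnorm ((F - 1) v) <= 1 / 4 * rnorm v.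
    rewrite bopDE bopNE bop1E; apply: (le_trans (rnorm_dist _ (E k.+2 t%:C v) _)).
    have := rnorm_bop_le v E8; rewrite bopDE bopNE; have := CE v; have := rnorm_ge0 v; lra.
  by have := rnorm_ge0 y; lra.
(* The interval [0, r] is cut into [N + 1] steps, each short enough for [step]. *)
have [N NP] : exists N : nat, 8 * (L * r) < N.+1%:R.
  exists (Num.bound (8 * (L * r))); apply: lt_trans (archi_boundP _) _.
    by rewrite !mulr_ge0// ltW.
  by rewrite ltr_nat.
have N0 : 0 < N.+1%:R :> R by rewrite ltr0n.
have Si i : (i <= N.+1)%N -> S (i%:R * (r / N.+1%:R)).
  elim: i => [_|i IHi iN].
    by exists 0; rewrite mul0r /C expr1 scale0r bnorm0 invr_ge0.
  have h0 : 0 <= r / N.+1%:R by apply: divr_ge0; exact: ltW.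
  have le_r j : (j <= N.+1)%N -> j%:R * (r / N.+1%:R) <= r.
    by move=> jN; rewrite mulrA ler_pdivrMr// mulrC (ler_wpM2l (ltW r0))// ler_nat.
  have pos_r j : 0 <= j%:R * (r / N.+1%:R) by rewrite mulr_ge0.
  have iN1 := ltnW iN; apply: step (IHi iN1); rewrite ?pos_r ?le_r//.
  rewrite -mulrBl -natr1 opprD addrA subrr add0r mulN1r normrN ger0_norm//.
  by rewrite mulrA ler_pdivrMr//; lra.
have [k] := Si N.+1 (leqnn _); rewrite mulrCA mulfV ?gt_eqF// mulr1 => Ck.
by exists (2 ^ k)%N.
Qed.

End QuasiNilpotent.
End Resolvent.

(** * Nonempty spectrum, boundary points and disconnectedness *)

Section Boundary.
Variables (R : realType) (H : hilbertSpace R).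
Implicit Types (A B C S T P E F N W X Y Z D J U V G : bop H) (x y : H) (a z w : R[i]).
Notation one := (1 : bop H).

(** Otherwise [quasinilpotent] with [r = |N| + 1] would give [|x| <= |N|^n |G^n x| <= r^n |G^n x| <=
    |x| / 2]. *)
Lemma nonzero_spectrum G N x : x <> 0 -> (forall n, (N ^+ n) ((G ^+ n) x) = x) ->
  exists z, z != 0 /\ ~ binv (G - z *: one).
Proof.
move=> x0 NG; apply: contrapT => /forallNP h.
have Ginv z : z != 0 -> binv (G - z *: one).
  by move=> z0; apply: contrapT => Gz; apply: (h z).
have N0 := bnorm_ge0 N.
have [n] := quasinilpotent x0 Ginv (r := bnorm N + 1) ltac:(lra).
rewrite bop_exprZ -rmorphXn /= => Gn.
have := rnorm_bop_le x Gn; rewrite bopZE rnorm_realZ; last by rewrite exprn_ge0// addr_ge0.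
have := rnorm_bop_le ((G ^+ n) x) (bnormX_le n (lexx (bnorm N))); rewrite NG.
have : bnorm N ^+ n <= (bnorm N + 1) ^+ n by rewrite lerXn2r ?nnegrE ?addr_ge0// lerDl.
by have := rnorm_gt0 x0; have := rnorm_ge0 ((G ^+ n) x); nra.
Qed.

Lemma binv_open T w : binv (T - w *: one) ->
  exists2 d, 0 < d & forall z, rnorm (z - w) < d -> binv (T - z *: one).
Proof.
move=> [S [S1 S2]]; have S0 := bnorm_ge0 S.
exists (bnorm S + 1)^-1; first by rewrite invr_gt0; lra.
move=> z zw; have -> : T - z *: one = (T - w *: one) - (z - w) *: one.
  by rewrite scalerBl opprB addrA subrK.
apply: (binv_perturb (d := rnorm (z - w)) S1 S2 (lexx _)).
  apply: (le_trans (bnormZ_le _ _)); have := rnorm_ge0 (z - w).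
  by have := bnorm1_le H; nra.
move: zw; rewrite -div1r ltr_pdivlMr; last by lra.
by have := rnorm_ge0 (z - w); nra.
Qed.

Lemma binv_large T z : bnorm T < rnorm z -> binv (T - z *: one).
Proof.
move=> Tz; have z0 : 0 < rnorm z by apply: le_lt_trans Tz; exact: bnorm_ge0.
have zN0 : z != 0 by apply/eqP => zE; move: z0; rewrite zE rnorm0 ltxx.
have -> : T - z *: one = (- z) *: (1 - z^-1 *: T).
  by rewrite scalerBr scalerA mulNr mulfV// !scaleNr scale1r opprK addrC.
apply: binvZ; first by rewrite oppr_eq0.
have [||J [J1 J2 _ _]] := @neumann _ _ (z^-1 *: T) (bnorm T / rnorm z).
- by apply: (le_trans (bnormZ_le _ _)); rewrite rnormV mulrC.
- by rewrite ltr_pdivrMr// mul1r.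
- by exists J.
Qed.

(** Either 0 is in the spectrum, or [T] has an inverse [S] and [S^n T^n = 1] makes
    [nonzero_spectrum] applicable. *)
Lemma spectrum_nonempty T x : x <> 0 -> exists z, ~ binv (T - z *: one).
Proof.
move=> x0; have [[S [ST TS]]|] := pselect (binv (T - 0 *: one)); last by exists 0.
rewrite scale0r subr0 in ST TS.
have [|z [_ Tz]] := @nonzero_spectrum T S x x0; last by exists z.
elim=> [|n IHn]; first by rewrite !expr0.
by rewrite exprSr [T ^+ _]exprS !bopME -(bopME S T) ST IHn.
Qed.

(** On the segment from a spectral point to a point outside the spectrum, take the supremum of the
    parameters that give spectral points; [binv_open] shows that it gives one too. *)
Lemma spectrum_boundary T x : x <> 0 -> exists l, ~ binv (T - l *: one) /\
  forall e : R, 0 < e -> exists2 w, rnorm (l - w) < e & binv (T - w *: one).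
Proof.
move=> x0; have [z0 Tz0] := spectrum_nonempty T x0.
have T0 := bnorm_ge0 T.
pose z1 : R[i] := (bnorm T + 1)%:C.
have Tz1 : binv (T - z1 *: one).
  by apply: binv_large; rewrite rnorm_real ger0_norm; lra.
pose z (t : R) := z0 + t%:C * (z1 - z0).
have zE0 : z 0 = z0 by rewrite /z mul0r addr0.
have zE1 : z 1 = z1 by rewrite /z mul1r addrC subrK.
have dist t s : rnorm (z t - z s) = `|t - s| * rnorm (z1 - z0).
  by rewrite /z opprD addrACA subrr add0r -mulrBl rnormM -rmorphB rnorm_real.
pose A := [set t : R | [/\ 0 <= t, t <= 1 & ~ binv (T - z t *: one)]].
have A0 : A 0 by split; rewrite ?zE0.
have sA : has_sup A by split; [exists 0 | exists 1 => t []].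
have D0 := rnorm_ge0 (z1 - z0); set D := rnorm (z1 - z0) in dist D0.
pose s := sup A; have s0 : 0 <= s by apply: sup_ubound => //; case: sA.
have s1 : s <= 1 by apply: ge_sup; [case: sA | move=> t []].
have Ts : ~ binv (T - z s *: one).
  move=> /binv_open[d d0 dP].
  have e0 : 0 < d / (D + 1) by apply: divr_gt0; lra.
  have [t At st] := sup_adherent e0 sA; have [_ _ tA] := At; apply: tA; apply: dP.
  have ts : t <= s by apply: sup_ubound At; case: sA.
  rewrite dist ler0_norm; last by lra.
  have : s - t < d / (D + 1) by rewrite -/s in st; lra.
  by rewrite ltr_pdivlMr; [nra | lra].
have {}s1 : s < 1.
  by rewrite lt_neqAle s1 andbT; apply/eqP => sE; apply: Ts; rewrite sE zE1.
exists (z s); split=> // e e0.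
have e'0 : 0 < e / (D + 1) by apply: divr_gt0; lra.
pose t := Num.min 1 (s + e / (D + 1) / 2).
have st : s < t by rewrite lt_min s1 /=; lra.
have t1 : t <= 1 by rewrite ge_min lexx.
have te : t - s < e / (D + 1).
  have : t <= s + e / (D + 1) / 2 by rewrite ge_min lexx orbT.
  by lra.
exists (z t).
  rewrite dist ler0_norm; last by lra.
  by move: te; rewrite ltr_pdivlMr; [nra | lra].
apply: contrapT => tA; have : t <= s; last by lra.
by apply: sup_ubound; [case: sA | split=> //; lra].
Qed.

(** A lower bound [d] for [T - l] gives the lower bound [2 d / 3] for [T - w] when
    [|l - w| < d / 3]. Its inverse then has norm at most [3 / (2 d)], and [T - l] is invertible as a
    perturbation of [T - w], the product of the two bounds being 1/2. *)
Lemma boundary_not_bounded_below T l : ~ binv (T - l *: one) ->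
  (forall e : R, 0 < e -> exists2 w, rnorm (l - w) < e & binv (T - w *: one)) ->
  forall d, 0 < d -> exists x, rnorm ((T - l *: one) x) < d * rnorm x.
Proof.
move=> Tl Tw d d0; apply: contrapT => /forallNP h.
have {}h x : d * rnorm x <= rnorm ((T - l *: one) x) by rewrite leNgt; apply/negP/h.
have [w lw [S [S1 S2]]] := Tw (d / 3) ltac:(lra).
apply: Tl; have TE : T - l *: one = (T - w *: one) - (l - w) *: one.
  by rewrite scalerBl opprB addrA subrK.
rewrite TE; apply: (binv_perturb (K := 3 / (2 * d)) (d := d / 3) S1 S2).
- apply: bnorm_le => [|y]; first by rewrite divr_ge0//; lra.
  have yE : (T - w *: one) (S y) = y by rewrite -bopME S2.
  have := h (S y); rewrite TE bopDE bopNE yE bopZE bop1E => hS.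
  have := rnormB y ((l - w) *: S y); rewrite rnormZ.
  have := rnorm_ge0 (S y); rewrite mulrAC ler_pdivlMr; last by lra.
  by move: lw; set u := rnorm (l - w); nra.
- apply: (le_trans (bnormZ_le _ _)); have := rnorm_ge0 (l - w).
  by have := bnorm1_le H; nra.
- have -> : 3 / (2 * d) * (d / 3) = 2^-1 by field; rewrite gt_eqF.
  by lra.
Qed.

(** The singleton of [p] is relatively open and closed in [A], and [q] shows that it is proper. *)
Lemma isolated_not_connected (A : set R[i]^o) (p q : R[i]) (d : R) :
  A p -> A q -> p <> q -> 0 < d -> (forall z, A z -> rnorm (z - p) < d -> z = p) ->
  ~ connected A.
Proof.
move=> Ap Aq pq d0 iso /(_ [set p : R[i]^o]) cA.
have : [set p : R[i]^o] = A; last by move=> pA; move: Aq; rewrite -pA => /esym.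
have d0C : 0 < d%:C by rewrite ltcR.
apply: cA; first by exists p.
- exists (ball (p : R[i]^o) d%:C); first exact: ball_open.
  apply/seteqP; split=> [_ ->|z [Az]]; first by split=> //; exact: ballxx.
  by rewrite -ball_normE /= -rnormE ltcR rnormBC => /(iso _ Az).
- exists [set p : R[i]^o]; first exact/accessible_closed_set1/hausdorff_accessible/norm_hausdorff.
  by apply/seteqP; split=> [_ ->|z []].
Qed.

End Boundary.

(** * Small perturbations that disconnect the spectrum *)

Section Disconnect.
Variables (R : realType) (H : hilbertSpace R) (M I : set (H -> H)).
Variable Phi : (H -> H) -> R.
Hypothesis hM : von_neumann_algebra M.
Hypothesis hdim : dim_gt1 M.
Hypothesis hI : ideal M I.
Hypothesis hPhi : norm_on I Phi.
Hypothesis hinv : unitarily_invariant M I Phi.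
Implicit Types (A B C S T P Q E F N W X Y Z D J U V G : bop H) (x y : H) (a z w : R[i]).
Notation one := (1 : bop H).
Notation inM := (bmem M).
Notation inI := (bmem I).
Notation PhiB := (PhiB Phi).

Lemma exists_nonzero_vector : exists x : H, x <> 0.
Proof.
apply: contrapT => /forallNP h; have [S [T [_ _ ST]]] := hdim.
have [] := ST 1 0; last by move/eqP; rewrite oner_eq0.
by apply: funext => x; rewrite (_ : _ x = 0) //; apply: contrapT => /(h _).
Qed.

(** If [S = s 1] and [T = t 1], then [t S - s T = 0] is a linear relation; independence forces
    [s = 0], and then [S = 0] is again dependent. *)
Lemma exists_nonscalar : exists2 A, inM A & forall z, A <> z *: one.
Proof.
apply: contrapT => h; have [S0 [T0 [MS0 MT0 ST]]] := hdim.
have [S MS SE] := inM_bop hM MS0; have [T MT TE] := inM_bop hM MT0.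
have scal A : inM A -> exists z, A = z *: one.
  by move=> MA; apply: contrapT => /forallNP Az; apply: h; exists A.
have {}ST a b : a *: S + b *: T = 0 -> a = 0 /\ b = 0.
  by move=> ab; apply: ST; rewrite -SE -TE; apply: funext => x; rewrite -[LHS]/((a *: S + b *: T) x) ab.
have [s sE] := scal S MS; have [t tE] := scal T MT.
have [|t0 /eqP] := ST t (- s).
  by rewrite sE tE !scalerA mulrC -scalerDl mulNr subrr scale0r.
rewrite oppr_eq0 => /eqP s0.
have [|/eqP] := ST 1 0; last by rewrite oner_eq0.
by rewrite sE s0 !scale0r scaler0 addr0.
Qed.

(** For a nonscalar [A] and a boundary point [l], [B = A - l] is nonzero but not bounded below. The
    threshold is half of [|B x1| / |x1|], so the spectral projection is nonzero and [x1] shows that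
    it is not 1. *)
Lemma exists_nontrivial_projection : exists Q,
  [/\ inM Q, radj Q Q, Q * Q = Q, Q <> 0 & Q <> 1].
Proof.
have [A MA Ans] := exists_nonscalar; have [x0 x0N] := exists_nonzero_vector.
have [l [Al Ab]] := spectrum_boundary A x0N.
set B := A - l *: one; have MB : inM B by apply: (inMB hM) => //; exact/(inMZ hM)/(inM1 hM).
have [x1 Bx1] : exists x1, B x1 <> 0.
  apply: contrapT => /forallNP h; apply: (Ans l); apply/eqP; rewrite -subr_eq0; apply/eqP.
  by apply: bopP => x; apply: contrapT => /(h _).
have Bx1_gt0 := rnorm_gt0 Bx1.
have x1_gt0 : 0 < rnorm x1 by apply: rnorm_gt0 => x10; apply: Bx1; rewrite x10 linear0.
have d0 : 0 < rnorm (B x1) / (2 * rnorm x1) by apply: divr_gt0; lra.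
have [x2 Bx2] := boundary_not_bounded_below Al Ab d0.
have [B' MB' BB'] := inM_adj hM MB.
have [P [[MP PP P2 P0] [BP _]]] := spectral_projection hM MB MB' BB' Bx2.
exists P; split=> // P1; have := BP x1; rewrite P1 bop1E.
have -> : rnorm (B x1) / (2 * rnorm x1) * rnorm x1 = rnorm (B x1) / 2.
  by field; rewrite gt_eqF.
by lra.
Qed.

Lemma bprojection_compl E : E * E = E -> (1 - E) * (1 - E) = 1 - E.
Proof. by move=> E2; rewrite mulrBr mulr1 mulrBl mul1r E2 subrr subr0. Qed.

Lemma binv_block E a : E * E = E -> a != 0 -> binv ((1 - E) + a *: E).
Proof.
move=> E2 a0; have EF : E * (1 - E) = 0 by rewrite mulrBr mulr1 E2 subrr.
have FE : (1 - E) * E = 0 by rewrite mulrBl mul1r E2 subrr.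
have F2 := bprojection_compl E2.
have F1 : (1 - E) + E = 1 by rewrite subrK.
move: (1 - E) EF FE F2 F1 => F EF FE F2 F1; exists (F + a^-1 *: E).
by split; rewrite mulrDl !mulrDr F2 -!bop_scaleAl -!bop_scaleAr FE EF E2 !scaler0
  addr0 add0r scalerA ?mulVf ?mulfV// scale1r.
Qed.

(* T is cut down to (T - l') (1 - E) + l': l' becomes an eigenvalue, and it is
   isolated because T - l' - (T - l) E is invertible. *)
Lemma spectrum_cut_not_connected T E (l l' : R[i]) (d : R) :
  E * E = E -> E <> 0 -> E <> 1 -> binv (T - l' *: one) -> l != l' ->
  (forall S, S * (T - l' *: one) = 1 -> bnorm S * d < 1) ->
  bnorm ((T - l *: one) * E) <= d ->
  ~ connected (spectrum (T - (T - l' *: one) * E)).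
Proof.
move=> E2 E0 E1 [S0 [S01 S02]] ll' Sd TEd.
(* [S] agrees with [T - l'] on the range of [1 - E] and is the scalar [m = l - l'] on that of [E].
   The operator [G] below, which is the perturbed operator minus [l'], differs only in vanishing on
   the range of [E]. *)
pose S := (T - l' *: one) - (T - l *: one) * E.
have [S' [S'S SS']] : binv S by exact: binv_perturb S01 S02 (lexx _) TEd (Sd _ S01).
have FE : (1 - E) * E = 0 by rewrite mulrBl mul1r E2 subrr.
have F2 := bprojection_compl E2.
set G := (T - l' *: one) * (1 - E); set m := l - l'.
have m0 : m != 0 by rewrite subr_eq0.
have SE : S * E = m *: E.
  rewrite /S mulrBl -mulrA E2 -mulrBl opprB addrC addrA subrK.
  by rewrite -scalerBl -bop_scaleAl mul1r.
have SF : S * (1 - E) = G.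
  by rewrite /S mulrBl -(mulrA _ E) (_ : E * (1 - E) = 0) ?mulr0 ?subr0// mulrBr mulr1 E2 subrr.
have GE z : T - (T - l' *: one) * E - (l' + z) *: one = G - z *: one.
  by rewrite /G mulrBr mulr1 scalerDl opprD addrA (addrAC T).
clearbody S G.
have GEE : G * E = 0 by rewrite -SF -mulrA FE mulr0.
have [d' d'0 Sz] : exists2 d', 0 < d' & forall z, rnorm z < d' -> binv (S - z *: one).
  have [|d' d'0 Sz] := @binv_open _ _ S 0.
    by rewrite scale0r subr0; exists S'.
  by exists d' => // z zd; apply: Sz; rewrite subr0.
(* Since [S - z] is [m - z] on the range of [E] and [G - z] is [- z] there, they differ by an
   invertible block factor. *)
have Gz z : z != 0 -> rnorm z < d' -> rnorm z < rnorm m -> binv (G - z *: one).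
  move=> z0 zd zm; have mz : m - z != 0.
    by apply/eqP => /subr0_eq mz; rewrite mz ltxx in zm.
  have -> : G - z *: one = (S - z *: one) * ((1 - E) + (- z / (m - z)) *: E).
    have SzF : (S - z *: one) * (1 - E) = G - z *: (1 - E).
      by rewrite mulrBl SF -bop_scaleAl mul1r.
    have SzE : (S - z *: one) * E = (m - z) *: E.
      by rewrite mulrBl SE -bop_scaleAl mul1r -scalerBl.
    rewrite mulrDr SzF -bop_scaleAr SzE scalerA divfK// scaleNr scalerBr opprB.
    by rewrite [z *: E - _]addrC addrA addrK.
  by apply: binvM; [exact: Sz | apply: binv_block; rewrite // mulf_neq0 ?invr_eq0 ?oppr_eq0].
(* A left inverse of [G] modulo [E]: [N G = 1 - E] and [N E = 0] give [N^n G^n = 1 - E] for positive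
   [n], so [G] has a nonzero spectral point. *)
pose N := (1 - E) * S'.
have NG : N * G = 1 - E by rewrite -SF /N -mulrA (mulrA S') S'S mul1r F2.
have S'E : S' * E = m^-1 *: E.
  have mS'E : m *: (S' * E) = E by rewrite bop_scaleAr -SE mulrA S'S mul1r.
  by rewrite -{2}mS'E scalerA mulVf// scale1r.
have NE : N * E = 0 by rewrite /N -mulrA S'E -bop_scaleAr FE scaler0.
have NF : N * (1 - E) = N by rewrite mulrBr mulr1 NE subr0.
have [y Fy0] : exists y, (1 - E) y <> 0.
  apply: contrapT => /forallNP h; apply: E1; apply/esym/eqP; rewrite -subr_eq0; apply/eqP.
  by apply: bopP => y; apply: contrapT => /(h _).
have NGn n : (N ^+ n) ((G ^+ n) ((1 - E) y)) = (1 - E) y.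
  case: n => [|n]; first by rewrite !expr0.
  suff NGE : N ^+ n.+1 * G ^+ n.+1 = 1 - E by rewrite -bopME NGE -bopME F2.
  elim: n => [|n IHn]; first by rewrite !expr1.
  by rewrite exprS [G ^+ _]exprSr !mulrA -(mulrA N) IHn NF NG.
have [z [z0 Gz0]] := nonzero_spectrum Fy0 NGn.
have m_gt0 : 0 < rnorm m by apply: rnorm_gt0; exact/eqP.
apply: (@isolated_not_connected _ _ l' (l' + z) (Num.min d' (rnorm m))).
- have := GE 0; rewrite addr0 scale0r subr0 => G0.
  apply/spectrumE; rewrite G0 => -[U [UG _]].
  by apply: E0; rewrite -(mul1r E) -UG -mulrA GEE mulr0.
- by apply/spectrumE; rewrite GE.
- by move=> /esym/eqP; rewrite -subr_eq0 addrC addKr (negPf z0).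
- by rewrite lt_min d'0 m_gt0.
- move=> w; rewrite -(subrK l' w); move: (w - l') => {}w.
  move=> /spectrumE; rewrite (addrC w) GE => wG.
  rewrite [l' + w]addrC addrK lt_min => /andP[wd wm]; apply: contrapT => wl; apply: wG.
  by apply: Gz => //; apply/eqP => w0; apply: wl; rewrite w0 add0r.
Qed.

Lemma small_disconnecting_perturbation (C : R) : 0 < C ->
  (forall P, inM P -> radj P P -> P * P = P -> P <> 0 -> exists E,
     [/\ inI E, E * E = E, E <> 0, P * E = E & PhiB E <= C] /\ radj E E) ->
  forall T (eps : R), inM T -> 0 < eps ->
  exists X, [/\ inI X, PhiB X < eps & ~ connected (spectrum (T + X))].
Proof.
move=> C0 hC T eps MT eps0; have [x0 x0N] := exists_nonzero_vector.
have [l [Tl Tb]] := spectrum_boundary T x0N.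
have [l' ll' [S [S1 S2]]] := Tb (eps / (4 * C)) ltac:(apply: divr_gt0; lra).
have S0 := bnorm_ge0 S.
(* The first bound keeps the cut operator invertible; the second makes the contribution of
   [(T - l) E] to the norm at most [eps / 2]. The term [(l' - l) E] contributes at most
   [eps / 4]. *)
have [d [d0 Sd dC]] : exists d, [/\ 0 < d, bnorm S * d < 1 & 2 * d * C <= eps / 2].
  exists (Num.min (eps / (4 * C)) (bnorm S + 1)^-1); split.
  - by rewrite lt_min invr_gt0 divr_gt0//=; lra.
  - apply: (@le_lt_trans _ _ (bnorm S * (bnorm S + 1)^-1)).
      by rewrite ler_wpM2l// ge_min lexx orbT.
    by rewrite ltr_pdivrMr; lra.
  - have : Num.min (eps / (4 * C)) (bnorm S + 1)^-1 <= eps / (4 * C).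
      by rewrite ge_min lexx.
    by rewrite ler_pdivlMr; lra.
have [x1 Tx1] := boundary_not_bounded_below Tl Tb d0.
set B := T - l *: one; have M1 z : inM (z *: one) by exact/(inMZ hM)/(inM1 hM).
have MB : inM B by exact: inMB.
have [B' MB' BB'] := inM_adj hM MB.
have [P [[MP PP P2 P0] [BP _]]] := spectral_projection hM MB MB' BB' Tx1.
(* A proper projection is needed: for [E = 1] the perturbed operator would be the scalar [l']. *)
have [Q [MQ QQ Q2 Q0 [Q1 BQ]]] : exists Q, [/\ inM Q, radj Q Q, Q * Q = Q, Q <> 0 &
    Q <> 1 /\ forall x, rnorm (B (Q x)) <= d * rnorm (Q x)].
  have [P1|P1] := pselect (P = 1); last by exists P.
  have [Q [MQ QQ Q2 Q0 Q1]] := exists_nontrivial_projection.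
  by exists Q; split=> //; split=> // x; have := BP (Q x); rewrite P1 bop1E.
have [E [[IE E2 E0 QE EC] EE]] := hC Q MQ QQ Q2 Q0.
have ME : inM E := inI_M hI IE.
have BE : bnorm (B * E) <= d.
  apply: bnorm_le => [|x]; first exact: ltW.
  rewrite bopME -QE bopME; apply: (le_trans (BQ _)).
  by rewrite -bopME QE ler_wpM2l ?rnorm_proj ?ltW.
have E1 : E <> 1 by move=> E1; apply: Q1; rewrite -(mulr1 Q) -E1 QE.
have ll'0 : l != l'.
  by apply/eqP => ll'0; apply: Tl; rewrite ll'0; exists S.
(* The factor [E] is written twice, so that [B E] is estimated in operator norm and the other [E] by
   [Phi]. *)
have XE : - ((T - l' *: one) * E) = - (B * E * E) + (l' - l) *: E.
  rewrite -mulrA E2 /B -!mulNr -{3}(mul1r E) bop_scaleAl -mulrDl !opprB; congr (_ * _).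
  by rewrite scalerBl [RHS]addrC addrA subrK.
have IBE : inI (B * E) := inIMl hI MB IE.
have IBEE : inI (- (B * E * E)).
  by rewrite -scaleN1r; exact/(inIZ hI)/(inIMr hI).
exists (- ((T - l' *: one) * E)); split.
- by rewrite XE; apply: (inID hI) => //; exact: (inIZ hI).
- rewrite XE; apply: (le_lt_trans (PhiBD hPhi IBEE (inIZ hI _ IE))).
  rewrite -scaleN1r !(PhiBZ hPhi)//; last exact: (inIMl hI (inMM hM MB ME) IE).
  rewrite rnormN rnorm1 mul1r.
  have := PhiB_Ml hM hI hPhi hinv (inMM hM MB ME) BE IE.
  move: ll'; rewrite rnormBC ltr_pdivlMr; last by lra.
  have := PhiB_ge0 hPhi IE; have := rnorm_ge0 (l' - l).
  nra.
- apply: (@spectrum_cut_not_connected T E l l' d) => //; first by exists S.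
  move=> S3 S3E; have -> : S3 = S by rewrite -(mulr1 S3) -S2 mulrA S3E mul1r.
  exact: Sd.
Qed.

End Disconnect.

(** * Projections below which the norm is large *)

Section PhiFloor.
Variables (R : realType) (H : hilbertSpace R) (M I : set (H -> H)).
Variable Phi : (H -> H) -> R.
Hypothesis hM : von_neumann_algebra M.
Hypothesis hI : ideal M I.
Hypothesis hdense : wot_dense M I.
Hypothesis hPhi : norm_on I Phi.
Hypothesis hinv : unitarily_invariant M I Phi.
Implicit Types (A B C S T P Q E F N W X Y Z D J U V G : bop H) (x y : H) (a z w : R[i]).
Notation one := (1 : bop H).
Notation inM := (bmem M).
Notation inI := (bmem I).
Notation PhiB := (PhiB Phi).

(** Choose [X] in the ideal near the identity in the single matrix coefficient at [(P x, P x)],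
    where the identity gives [|P x|^2], which is nonzero. *)
Lemma wot_dense_nonzero P : P <> 0 -> exists2 X, inI X & X * P <> 0.
Proof.
move=> P0; have [x Px0] : exists x, P x <> 0.
  by apply: contrapT => /forallNP h; apply: P0; apply: bopP => x; apply: contrapT => /(h _).
pose O := [set f : {ptws (H * H)%type -> R[i]^o} | f (P x, P x) != 0].
have Oo : open O.
  have oC : open (~` [set (0 : R[i]^o)]).
    exact/closed_openC/accessible_closed_set1/hausdorff_accessible/norm_hausdorff.
  have -> : O = [set f : {ptws (H * H)%type -> R[i]^o} | (~` [set (0 : R[i]^o)]) (f (P x, P x))].
    by apply/seteqP; split=> f /=; [move/eqP | move=> h; apply/eqP].
  have pc : continuous (fun f : {ptws (H * H)%type -> R[i]^o} => f (P x, P x)).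
    exact: (@proj_continuous _ (fun=> R[i]^o) (P x, P x)).
  exact: (continuousP _).1 pc _ oC.
have nO : nbhs (idfun : initial_topology (@matrix_coef R H)) (@matrix_coef R H @^-1` O).
  exists (@matrix_coef R H @^-1` O); split=> //; first by exists O.
  rewrite /O /= /matrix_coef /= -inner_normE expf_eq0 /= normr_eq0.
  exact/eqP.
have [X0 [IX0 OX0]] := hdense (vna_one hM) nO.
have [X MX XE] := inM_bop hM (ideal_sub hI IX0).
exists X; first by rewrite /bmem XE.
move=> XP; move: OX0; rewrite /O /= /matrix_coef /= -XE -bopME XP bop0E.
by rewrite linear0l eqxx.
Qed.

Definition bproj P := radj P P /\ P * P = P.

Lemma bproj_leC E P : bproj E -> bproj P -> E * P = E -> P * E = E.
Proof.
move=> [EE _] [PP _] EP; apply: (@radj_uniq _ _ E) => //.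
by rewrite -{1}EP; apply: radjM.
Qed.

(** The infimum attached to [P] in statement (1) is at least [n]. *)
Definition Phi_floor P (n : R) := forall E, inI E -> bproj E -> E <> 0 -> P * E = E ->
  n <= PhiB E.

Lemma floorS P E n : P * E = E -> Phi_floor P n -> Phi_floor E n.
Proof. by move=> PE Pn F IF pF F0 EF; apply: Pn => //; rewrite -EF mulrA PE. Qed.

(** The projection that [factor_projection] extracts from [X P] lies in the ideal because [X] does,
    and below [P] because [X P P = X P]. *)
Lemma exists_sub_ideal P : inM P -> bproj P -> P <> 0 ->
  exists E, [/\ inI E, bproj E, E <> 0 & P * E = E].
Proof.
move=> MP pP P0; have [X IX XP] := wot_dense_nonzero P0.
have MXP : inM (X * P) by apply: (inMM hM) => //; exact: (ideal_sub hI).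
have [E [Z [[ME EE E2 E0] [MZ ZE _]]]] := factor_projection hM MXP XP.
exists E; split=> //; first by rewrite -ZE; apply/(inIMl hI)/(inIMr hI).
by apply: bproj_leC => //; rewrite -ZE -!mulrA (proj2 pP).
Qed.

(** Extract from [X E] a projection [P = Z X E] below [E]. Then [n <= Phi P <= 4 |Z| Phi X], while
    [|Z| |X E| <= 2]. *)
Lemma floor_norm_r X E n : inI X -> inM E -> bproj E -> Phi_floor E n ->
  n * bnorm (X * E) <= 8 * PhiB X.
Proof.
move=> IX ME pE En; have [->|/eqP XE0] := eqVneq (X * E) 0.
  by rewrite bnorm0 mulr0 mulr_ge0// (PhiB_ge0 hPhi).
have MX : inM X := ideal_sub hI IX.
have [P [Z [[MP PP P2 P0] [MZ ZP Zn]]]] := factor_projection hM (inMM hM MX ME) XE0.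
have IZX : inI (Z * X) := inIMl hI MZ IX.
have nP : n <= PhiB P.
  apply: En => //; first by rewrite -ZP mulrA; exact: (inIMr hI).
  by apply: bproj_leC => //; rewrite -ZP -!mulrA (proj2 pE).
have E1 : bnorm E <= 1 by case: pE => *; exact: bnorm_proj.
have h1 := PhiB_Mr hM hI hPhi hinv ME E1 IZX.
have h2 := PhiB_Ml hM hI hPhi hinv MZ (lexx _) IX.
rewrite -mulrA ZP in h1; have := bnorm_ge0 (X * E); have := PhiB_ge0 hPhi IX.
nra.
Qed.

(** The projection is extracted from the adjoint [X' E] of [E X]. Being self-adjoint it also equals
    [E X Z'], so only the value of [Phi] at [X], not at [X'], enters the estimate. *)
Lemma floor_norm_l X E n : inI X -> inM E -> bproj E -> Phi_floor E n ->
  n * bnorm (E * X) <= 8 * PhiB X.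
Proof.
move=> IX ME pE En; have MX : inM X := ideal_sub hI IX.
have [X' MX' XX'] := inM_adj hM MX.
have EX' : radj (X' * E) (E * X) by apply: radjM; [exact: radj_sym | exact: (proj1 pE)].
have [EX0|/eqP XE0] := eqVneq (X' * E) 0.
  have -> : E * X = 0.
    by apply: bnorm_eq0; apply: (le_trans (bnorm_radj EX')); rewrite EX0 bnorm0.
  by rewrite bnorm0 mulr0 mulr_ge0// (PhiB_ge0 hPhi).
have [P [Z [[MP PP P2 P0] [MZ ZP Zn]]]] := factor_projection hM (inMM hM MX' ME) XE0.
have [Z' MZ' ZZ'] := inM_adj hM MZ.
have PE : P = E * X * Z'.
  by apply: (@radj_uniq _ _ P) => //; rewrite -{1}ZP; exact: radjM.
have IEX : inI (E * X) := inIMl hI ME IX.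
have nP : n <= PhiB P.
  apply: En => //; first by rewrite PE; exact: (inIMr hI).
  by apply: bproj_leC => //; rewrite -ZP -!mulrA (proj2 pE).
have E1 : bnorm E <= 1 by case: pE => *; exact: bnorm_proj.
have h1 := PhiB_Mr hM hI hPhi hinv MZ' (bnorm_radj ZZ') IEX.
have h2 := PhiB_Ml hM hI hPhi hinv ME E1 IX.
rewrite -PE in h1; have h3 := bnorm_radj EX'.
have Zb : bnorm Z * bnorm (E * X) <= 2.
  by apply: le_trans Zn; rewrite ler_wpM2l ?bnorm_ge0.
have b0 := bnorm_ge0 (E * X); have q0 := PhiB_ge0 hPhi IEX.
apply: (@le_trans _ _ (2 * bnorm Z * PhiB (E * X) * bnorm (E * X))).
  by rewrite ler_wpM2r//; exact: le_trans h1.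
by nra.
Qed.

(** If [E F] were nonzero, a projection [P = Z E (E F)] below [F] would satisfy
    [Phi P <= 4 |Z| |E F| Phi E <= 8 Phi E]. *)
Lemma floor_orthogonal E F n : inI E -> bproj E -> inM F -> bproj F -> Phi_floor F n ->
  8 * PhiB E < n -> E * F = 0.
Proof.
move=> IE pE MF pF Fn En; apply: contrapT => EF0.
have ME : inM E := ideal_sub hI IE.
have [P [Z [[MP PP P2 P0] [MZ ZP Zn]]]] := factor_projection hM (inMM hM ME MF) EF0.
have IZE : inI (Z * E) := inIMl hI MZ IE.
have PE : P = Z * E * (E * F) by rewrite -ZP -(mulrA Z) (mulrA E) (proj2 pE).
have nP : n <= PhiB P.
  apply: Fn => //; first by rewrite PE; apply: (inIMr hI) => //; exact: inMM.
  by apply: bproj_leC => //; rewrite -ZP -!mulrA (proj2 pF).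
have h1 := PhiB_Mr hM hI hPhi hinv (inMM hM ME MF) (lexx _) IZE.
have h2 := PhiB_Ml hM hI hPhi hinv MZ (lexx _) IE.
rewrite -PE in h1; have := bnorm_ge0 (E * F); have := PhiB_ge0 hPhi IE.
by have := PhiB_ge0 hPhi IZE; nra.
Qed.

Hypothesis bad : forall n : R, exists P, [/\ inM P, bproj P, P <> 0 & Phi_floor P n].

Lemma exists_orthogonal_sequence (n : nat -> R) : exists E : nat -> bop H,
  (forall k, [/\ inI (E k), bproj (E k), E k <> 0 & Phi_floor (E k) (n k)]) /\
  (forall j k, j <> k -> E j * E k = 0).
Proof.
have next (s : seq (bop H)) : exists E,
    [/\ inI E, bproj E, E <> 0 & Phi_floor E (n (size s))] /\
    (forall F, F \in s -> inI F -> bproj F -> F * E = 0).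
  (* The sum plus 1 exceeds [8 Phi F] for each earlier [F] in the ideal, which forces orthogonality;
     the other entry is the prescribed floor. *)
  pose m := Num.max (n (size s)) (\sum_(F <- s) `|8 * PhiB F| + 1).
  have [P [MP pP P0 Pm]] := bad m; have [E [IE pE E0 PE]] := exists_sub_ideal MP pP P0.
  exists E; split.
    by split=> // F IF pF F0 EF; apply: le_trans (floorS PE Pm IF pF F0 EF); rewrite le_max lexx.
  move=> F Fs IF pF; rewrite -PE mulrA (floor_orthogonal IF pF MP pP Pm) ?mul0r//.
  rewrite lt_max; apply/orP; right; rewrite (big_rem F)//=.
  have : 0 <= \sum_(F <- rem F s) `|8 * PhiB F| by apply: sumr_ge0.
  by have := ler_norm (8 * PhiB F); lra.
have [f fP] := choice next.
pose s := fix s k := if k is k'.+1 then f (s k') :: s k' else [::].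
have ss k : size (s k) = k by elim: k => //= k ->.
have ins j k : (j < k)%N -> f (s j) \in s k.
  elim: k => // k IHk; rewrite ltnS leq_eqVlt => /predU1P[->|/IHk jk] /=.
    by rewrite inE eqxx.
  by rewrite inE jk orbT.
pose E k := f (s k).
have EP k : [/\ inI (E k), bproj (E k), E k <> 0 & Phi_floor (E k) (n k)].
  by have [] := fP (s k); rewrite ss.
have Elt j k : (j < k)%N -> E j * E k = 0.
  by move=> jk; have [_] := fP (s k); have [Ij pj _ _] := EP j; apply=> //; exact: ins.
exists E; split=> // j k /eqP; rewrite neq_ltn => /orP[/Elt//|/Elt kj].
have [_ [Ej _] _ _] := EP j; have [_ [Ek _] _ _] := EP k.
apply: (@radj_uniq _ _ (E k * E j)); first exact: radjM.
by rewrite kj; exact: radj0.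
Qed.

End PhiFloor.

(** * A dense sequence in the unit disc *)

Section DenseSequence.
Variable R : realType.

(** The radii start at 1/2 and increase by [2^(-N-2)], which leaves room for the two off-diagonal
    corners of the perturbation at each stage. *)
Definition disc_radius (N : nat) : R := 1 - 2^-1 ^+ N.+1.

Lemma half_exp_gt0 N : 0 < (2^-1 : R) ^+ N.
Proof. by rewrite exprn_gt0// invr_gt0. Qed.

Lemma disc_radius_ge0 N : 0 <= disc_radius N.
Proof. by rewrite subr_ge0 exprn_ile1 ?invf_le1 ?invr_ge0 ?ler1n. Qed.

Lemma half_exp_small (e : R) : 0 < e -> exists N0, forall N, (N0 <= N)%N -> 2^-1 ^+ N < e.
Proof.
move=> e0; have ei : 0 <= e^-1 by rewrite invr_ge0 ltW.
exists (Num.bound e^-1) => N NN; rewrite exprVn -[e]invrK ltf_pV2 ?posrE ?exprn_gt0 ?invr_gt0//.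
apply: (lt_trans (archi_boundP ei)); rewrite -natrX ltr_nat.
by apply: leq_ltn_trans NN _; exact: ltn_expl.
Qed.

Lemma complex_rat_approx (z : R[i]) (e : R) : 0 < e ->
  exists p q : rat, rnorm ((ratr p +i* ratr q) - z) < e.
Proof.
move=> e0; have approx (r : R) : exists p : rat, `|ratr p - r| < e / 2.
  have [|p] := rat_in_itvoo (x := r - e / 2) (y := r + e / 2); first by lra.
  by rewrite in_itv /= => /andP[p1 p2]; exists p; rewrite ltr_norml; apply/andP; split; lra.
have [p hp] := approx (complex.Re z); have [q hq] := approx (complex.Im z).
exists p, q; have -> : (ratr p +i* ratr q) - z =
    (ratr p - complex.Re z)%:C + 'i * (ratr q - complex.Im z)%:C.
  by case: z {hp hq} => a b; apply/eqP; rewrite eq_complex /=; apply/andP; split; apply/eqP; ring.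
by apply: (le_lt_trans (rnormD _ _)); rewrite rnormM rnorm_i mul1r !rnorm_real; lra.
Qed.

(* The 2-adic valuation of N+1 takes every value infinitely often; here it
   enumerates the Gaussian rationals. *)
Definition disc_point (N : nat) : R[i] :=
  if unpickle (logn 2 N.+1) is Some (p, q)
  then let z := (ratr p : R) +i* ratr q in if rnorm z <= disc_radius N then z else 0
  else 0.

Lemma rnorm_disc_point N : rnorm (disc_point N) <= disc_radius N.
Proof.
rewrite /disc_point; case: unpickle => [[p q]|]; last by rewrite rnorm0 disc_radius_ge0.
by case: ifP => //; rewrite rnorm0 disc_radius_ge0.
Qed.

Lemma disc_point_dense (z : R[i]) (e : R) N0 : rnorm z <= 1 -> 0 < e ->
  exists2 N, (N0 <= N)%N & rnorm (disc_point N - z) < e.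
Proof.
move=> z1 e0; pose t := Num.min e 1.
have t0 : 0 < t by rewrite lt_min e0 ltr01.
have te : t <= e by rewrite ge_min lexx.
have t1 : t <= 1 by rewrite ge_min lexx orbT.
(* Shrinking [z] first keeps the rational approximation strictly inside the unit disc. *)
have [p [q pq]] := complex_rat_approx ((1 - t / 2)%:C * z) (e := t / 2) ltac:(lra).
set w := ratr p +i* ratr q in pq.
have nz : rnorm ((1 - t / 2)%:C * z) = (1 - t / 2) * rnorm z.
  by rewrite rnormM rnorm_real ger0_norm//; lra.
have w1 : rnorm w < 1.
  have := rnormD (w - (1 - t / 2)%:C * z) ((1 - t / 2)%:C * z); rewrite subrK nz.
  by have := rnorm_ge0 z; nra.
have wz : rnorm (w - z) < e.
  have := rnorm_dist w ((1 - t / 2)%:C * z) z.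
  have -> : (1 - t / 2)%:C * z - z = (- (t / 2))%:C * z.
    by rewrite rmorphB /= rmorph1 mulrBl mul1r addrAC subrr add0r rmorphN mulNr.
  rewrite rnormM rnorm_real normrN ger0_norm; last by lra.
  by have := rnorm_ge0 z; nra.
have [|N1 N1P] := half_exp_small (e := 1 - rnorm w); first by lra.
(* [m] is odd, so [N + 1 = 2^v m] has valuation [v]; it is large, so [N] exceeds [N0] and
   [disc_radius N] exceeds [|w|]. *)
pose v := pickle (p, q); pose m := (2 * maxn N0 N1 + 1)%N.
pose N := (2 ^ v * m).-1.
have m0 : (0 < m)%N by rewrite /m addn1.
have NE : N.+1 = (2 ^ v * m)%N by rewrite prednK// muln_gt0 expn_gt0 m0.
have mN : (m <= N.+1)%N by rewrite NE leq_pmull// expn_gt0.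
have lE : logn 2 N.+1 = v.
  rewrite NE lognM ?expn_gt0// pfactorK// logn_coprime ?addn0//.
  by rewrite prime_coprime// dvdn2 /m oddD mul2n odd_double.
have maxN : (maxn N0 N1 <= N)%N.
  by rewrite -ltnS; apply: leq_trans mN; rewrite /m addn1 ltnS mul2n -addnn leq_addr.
exists N; first by apply: leq_trans maxN; exact: leq_maxl.
rewrite /disc_point lE pickleK -/w ifT// /disc_radius.
have := N1P N.+1 ltac:(apply: leqW; apply: leq_trans maxN; exact: leq_maxr).
lra.
Qed.

(** The disc is a union of radial segments through 0. *)
Lemma unit_disc_connected : connected [set z : R[i]^o | rnorm (z : R[i]) <= 1].
Proof.
pose f (z : R[i]) (t : R) : R[i]^o := t%:C * z.
have fc z : continuous (f z).
  move=> t; apply/cvgrPdist_lt => e; rewrite ltcE => /andP[/eqP /= ei e0].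
  have eE : e = (complex.Re e)%:C by rewrite RRe_real// realE lecE ei eqxx (ltW e0).
  have z0 := rnorm_ge0 z.
  have d0 : 0 < complex.Re e / (rnorm z + 1) by apply: divr_gt0; lra.
  apply/nbhs_ballP; exists (complex.Re e / (rnorm z + 1)) => //= s.
  rewrite /ball /= ltr_pdivlMr; last by lra.
  move=> ts; rewrite eE -rnormE ltcR /f -mulrBl -rmorphB rnormM rnorm_real.
  by have := normr_ge0 (t - s); nra.
have -> : [set z : R[i]^o | rnorm (z : R[i]) <= 1] =
    \bigcup_(z in [set z : R[i] | rnorm z <= 1]) (f z @` `[0, 1]%classic).
  apply/seteqP; split=> [z z1|_ [z z1 [t /= + <-]]].
    exists z => //; exists 1; first by rewrite /= in_itv /= ler01 lexx.
    by rewrite /f mul1r.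
  rewrite in_itv /= => /andP[t0 t1]; rewrite /f rnormM rnorm_real ger0_norm//.
  by rewrite mulr_ile1// rnorm_ge0.
apply: bigcup_connected.
  by exists 0 => z z1; exists 0; [rewrite /= in_itv /= lexx ler01 | rewrite /f mul0r].
move=> z _; apply: connected_continuous_connected; first exact: segment_connected.
exact: continuous_subspaceT.
Qed.

End DenseSequence.

(** * Diagonal sums over orthogonal projections *)

Section DiagonalOperator.
Variables (R : realType) (H : hilbertSpace R).
Implicit Types (A B C S T P Q F W X Y Z D J U V G : bop H) (x y : H) (a z w : R[i]).
Notation one := (1 : bop H).

Lemma pythagoras x y : rip x y = 0 -> rnorm (x + y) ^+ 2 = rnorm x ^+ 2 + rnorm y ^+ 2.
Proof. by move=> xy; rewrite -!ripxx ripDl !ripDr (ripC y) xy; ring. Qed.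

(* Compression to the block decomposition 1 = (1 - P) + P. *)
Lemma bnorm_add_corner Y P a (r c : R) : bproj P -> bnorm Y <= r -> rnorm a <= r ->
  bnorm (P * Y) <= c -> bnorm (Y * P) <= c -> bnorm (Y + a *: P) <= r + (c + c).
Proof.
move=> [PP P2] Yr ar PYc YPc; have r0 : 0 <= r by apply: le_trans ar; exact: rnorm_ge0.
have QQ : radj (1 - P) (1 - P) by apply: radjB; first exact: radj1.
have Q2 := bprojection_compl P2.
have PQ : P * (1 - P) = 0 by rewrite mulrBr mulr1 P2 subrr.
have Q1 : bnorm (1 - P) <= 1 by exact: bnorm_proj.
have QP1 x : (1 - P) x + P x = x by rewrite bopDE bopNE subrK.
(* The first group is block diagonal, so its norm is bounded by the larger of the two block bounds;
   the second has norm at most [c + c]. *)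
have YE : Y + a *: P =
    ((1 - P) * Y * (1 - P) + a *: P) + (P * Y + (1 - P) * (Y * P)).
  rewrite [RHS]addrAC !addrA; congr (_ + _).
  rewrite [X in _ = X + _]addrC -addrA mulrA -mulrDr subrK mulr1.
  by rewrite -mulrDl addrC subrK mul1r.
rewrite YE; apply: (le_trans (bnormD _ _)); apply: lerD; last first.
  apply: (le_trans (bnormD _ _)); apply: lerD => //.
  by rewrite -(mul1r c); exact: bnormM_le.
apply: bnorm_le => // x.
rewrite -(ler_pXn2r (n := 2)) ?nnegrE ?mulr_ge0 ?rnorm_ge0//.
have xE : rnorm x ^+ 2 = rnorm ((1 - P) x) ^+ 2 + rnorm (P x) ^+ 2.
  by rewrite -pythagoras ?QP1// ripC PP -bopME PQ bop0E /rip linear0r.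
rewrite bopDE pythagoras; last first.
  rewrite bopZE -bop_scale ripC PP.
  by rewrite -bopME !mulrA PQ !mul0r bop0E /rip linear0r.
rewrite bopZE rnormZ exprMn [X in _ <= X]exprMn xE (mulrDr (r ^+ 2)); apply: lerD.
  rewrite -mulrA bopME; apply: (@le_trans _ _ (rnorm (Y ((1 - P) x)) ^+ 2)).
    rewrite ler_sqr ?nnegrE ?rnorm_ge0//; exact: rnorm_proj.
  by rewrite -exprMn ler_sqr ?nnegrE ?mulr_ge0 ?rnorm_ge0//; exact: rnorm_bop_le.
by rewrite ler_wpM2r ?sqr_ge0// ler_sqr ?nnegrE ?rnorm_ge0.
Qed.

Variables (E : nat -> bop H) (l : nat -> R[i]).
Hypothesis pE : forall k, bproj (E k).
Hypothesis oE : forall j k, j <> k -> E j * E k = 0.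
Hypothesis l1 : forall k, rnorm (l k) <= 1.

Fixpoint diag_sum (N : nat) : bop H :=
  if N is N'.+1 then diag_sum N' + l N' *: E N' else 0.

Lemma diag_sumS N : diag_sum N.+1 = diag_sum N + l N *: E N. Proof. by []. Qed.

Lemma diag_sum_mull N k : (N <= k)%N -> E k * diag_sum N = 0.
Proof.
elim: N => [|N IHN] Nk; first by rewrite mulr0.
rewrite diag_sumS mulrDr IHN ?(ltnW Nk)// -bop_scaleAr oE ?scaler0 ?addr0//.
by apply/eqP; rewrite gtn_eqF.
Qed.

Lemma diag_sum_mulr N k : (N <= k)%N -> diag_sum N * E k = 0.
Proof.
elim: N => [|N IHN] Nk; first by rewrite mul0r.
rewrite diag_sumS mulrDl IHN ?(ltnW Nk)// -bop_scaleAl oE ?scaler0 ?addr0//.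
by apply/eqP; rewrite ltn_eqF.
Qed.

Lemma diag_sum_corner N k : (k < N)%N -> diag_sum N * E k = l k *: E k.
Proof.
elim: N => // N IHN; rewrite ltnS leq_eqVlt diag_sumS mulrDl => /predU1P[->|kN].
  by rewrite diag_sum_mulr// add0r -bop_scaleAl (proj2 (pE N)).
rewrite IHN// -bop_scaleAl oE ?scaler0 ?addr0//.
by apply/eqP; rewrite gtn_eqF.
Qed.

Definition mass x (N : nat) : R := \sum_(k < N) rnorm (E k x) ^+ 2.

Lemma massS x N : mass x N.+1 = mass x N + rnorm (E N x) ^+ 2.
Proof. by rewrite /mass big_ord_recr. Qed.

Lemma mass_mono x n k : mass x n <= mass x (n + k)%N.
Proof.
elim: k => [|k IHk]; first by rewrite addn0.
by rewrite addnS massS; apply: (le_trans IHk); rewrite lerDl sqr_ge0.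
Qed.

(** The summands have orthogonal ranges and coefficients of modulus at most 1, so Pythagoras applies
    term by term. *)
Lemma rnorm_diag_sumB x n k :
  rnorm (diag_sum (n + k) x - diag_sum n x) ^+ 2 <= mass x (n + k)%N - mass x n.
Proof.
elim: k => [|k IHk]; first by rewrite addn0 !subrr rnorm0 expr0n.
have [EE E2] := pE (n + k)%N.
rewrite addnS diag_sumS massS bopDE addrAC pythagoras.
  rewrite [leRHS]addrAC lerD// bopZE rnormZ exprMn ler_piMl ?sqr_ge0//.
  by rewrite expr_le1 ?rnorm_ge0.
rewrite bopZE -bop_scale ripC EE bop_sub -!bopME !diag_sum_mull ?leq_addr//.
by rewrite subr0 bop0E /rip linear0r.
Qed.

Lemma rnorm_diag_sum x N : rnorm (diag_sum N x) ^+ 2 <= mass x N.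
Proof.
have := rnorm_diag_sumB x 0 N.
by rewrite add0n bop0E subr0 /mass big_ord0 subr0.
Qed.

End DiagonalOperator.

(** * Bessel's inequality and the diagonal operator *)

Section Bessel.
Variables (R : realType) (H : hilbertSpace R) (E : nat -> bop H).
Hypothesis pE : forall k, bproj (E k).
Hypothesis oE : forall j k, j <> k -> E j * E k = 0.

(** With [F] the sum of the first [N] projections, [0 <= |x - F x|^2 = |x|^2 - 2 <F x, x> + |F
    x|^2], where [<F x, x>] is the mass and [|F x|^2] is at most the mass. *)
Lemma bessel x N : mass E x N <= rnorm x ^+ 2.
Proof.
pose F := diag_sum E (fun=> 1); have l1 (k : nat) : rnorm (1 : R[i]) <= 1 by rewrite rnorm1.
have ripF : rip (F N x) x = mass E x N.
  elim: N => [|N IHN]; first by rewrite bop0E /rip linear0l /mass big_ord0.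
  have [EE E2] := pE N.
  by rewrite /F diag_sumS scale1r bopDE ripDl IHN massS -ripxx (EE x (E N x)) -bopME E2 (ripC x).
have := rnorm_diag_sum pE oE l1 x N; rewrite -/F => Fm.
have : 0 <= rnorm (x - F N x) ^+ 2 by exact: sqr_ge0.
rewrite -ripxx ripBl !ripBr (ripC x) ripF !ripxx; clear l1; lra.
Qed.

(** The partial sums are strongly Cauchy because the masses increase and are bounded by Bessel.
    Applied to [E k x] they are constant from index [k + 1] on. *)
Lemma diag_operator (l : nat -> R[i]) : (forall k, rnorm (l k) <= 1) ->
  exists2 T : bop H, forall x, slim (fun n => diag_sum E l n x) (T x) &
    forall k, T * E k = l k *: E k.
Proof.
move=> l1.
have [T ST _] : exists2 T : bop H, forall x, slim (fun n => diag_sum E l n x) (T x) & bnorm T <= 1.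
  apply: bop_limit => [n|x e e0].
    apply: bnorm_le => // x; rewrite mul1r -(ler_pXn2r (n := 2)) ?nnegrE ?rnorm_ge0//.
    exact: le_trans (rnorm_diag_sum pE oE l1 x n) (bessel x n).
  have sm : has_sup (range (mass E x)).
    by split; [exists (mass E x 0); exists 0%N | exists (rnorm x ^+ 2) => _ [n _ <-]; exact: bessel].
  have [_ [N _ <-] mN] := sup_adherent (exprn_gt0 2 e0) sm.
  exists N => m n Nn nm; rewrite -(ltr_pXn2r (n := 2)) ?nnegrE ?rnorm_ge0 ?ltW//.
  rewrite -(subnKC nm); apply: (le_lt_trans (rnorm_diag_sumB pE oE l1 _ _ _)).
  have : mass E x (n + (m - n))%N <= sup (range (mass E x)).
    by apply: sup_ubound; [case: sm | exists (n + (m - n))%N].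
  by have := mass_mono E x N (n - N); rewrite subnKC//; lra.
exists T => // k; apply: bopP => x; rewrite bopME.
apply: slim_unique (ST (E k x)) _ => e e0; exists k.+1 => n kn.
by rewrite -bopME diag_sum_corner// subrr rnorm0.
Qed.

End Bessel.

(** * An operator whose spectrum stays connected *)

Section ConnectedSpectrum.
Variables (R : realType) (H : hilbertSpace R) (M I : set (H -> H)).
Variable Phi : (H -> H) -> R.
Hypothesis hM : von_neumann_algebra M.
Hypothesis hI : ideal M I.
Hypothesis hdense : wot_dense M I.
Hypothesis hPhi : norm_on I Phi.
Hypothesis hinv : unitarily_invariant M I Phi.
Hypothesis hdom : norm_dominating I Phi.
Notation one := (1 : bop H).
Notation inM := (bmem M).
Notation inI := (bmem I).
Notation PhiB := (PhiB Phi).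

Lemma stable_connected_spectrum :
  (forall n : R, exists P, [/\ inM P, bproj P, P <> 0 & Phi_floor I Phi P n]) ->
  exists2 T, inM T & forall X, inI X -> PhiB X < 2^-1 ->
    connected (spectrum (T + X : bop H)).
Proof.
move=> bad; pose c N : R := 2^-1 ^+ N.+3.
(* The floor [8 / c N] turns the bounds [n |X E| <= 8 Phi X] and [n |E X| <= 8 Phi X] into corners
   of norm at most [c N]. *)
have [E [EP oE]] := exists_orthogonal_sequence hM hI hdense hPhi hinv bad (fun N => 8 / c N).
have pE k : bproj (E k) by case: (EP k).
have IE k : inI (E k) by case: (EP k).
have ME k : inM (E k) := ideal_sub hI (IE k).
have r1 N : disc_radius R N <= 1 by rewrite lerBlDr lerDl ltW// half_exp_gt0.
have l1 k : rnorm (disc_point R k) <= 1 := le_trans (rnorm_disc_point _ _) (r1 _).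
have [T TS TE] := diag_operator pE oE l1.
exists T.
  apply: (inM_slim hM) TS; elim=> [|n IHn]; first exact: inM0.
  by rewrite diag_sumS; apply: (inMD hM) => //; exact: inMZ.
move=> X IX X1.
have c0 N : 0 < c N by exact: half_exp_gt0.
have small N (b : R) : 8 / c N * b <= 8 * PhiB X -> b <= c N.
  move=> h; have : 8 / c N * b <= 8 by lra.
  by rewrite mulrAC ler_pdivrMr//; have := c0 N; nra.
have XE N : bnorm (X * E N) <= c N.
  by apply: small; have [_ _ _ bE] := EP N; exact: (floor_norm_r hM hI hPhi hinv IX (ME N) (pE N) bE).
have EX N : bnorm (E N * X) <= c N.
  by apply: small; have [_ _ _ bE] := EP N; exact: (floor_norm_l hM hI hPhi hinv IX (ME N) (pE N) bE).
(* The base case is [|X| <= Phi X < 1/2 = disc_radius 0]. In the inductive step, [E N] annihilates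
   [diag_sum N] on both sides, so the corners of [diag_sum N + X] are those of [X]. *)
have TNX N : bnorm (diag_sum E (disc_point R) N + X) <= disc_radius R N.
  elim: N => [|N IHN].
    rewrite add0r; apply: (le_trans (hdom IX)).
    by have := X1; rewrite /disc_radius expr1 /PhiB; lra.
  rewrite diag_sumS addrAC.
  have -> : disc_radius R N.+1 = disc_radius R N + (c N + c N).
    by rewrite /disc_radius /c !exprS; move: (2^-1 ^+ N) => u; field.
  apply: bnorm_add_corner => //; first exact: rnorm_disc_point.
    by rewrite mulrDr diag_sum_mull// add0r.
  by rewrite mulrDl diag_sum_mulr// add0r.
have TX1 : bnorm (T + X) <= 1.
  apply: bnorm_le => // x; rewrite mul1r.
  apply: slim_le (slimD (TS x) (slim_cst (X x))) _ => N.
  by rewrite -[rnorm x]mul1r -bopDE; apply: rnorm_bop_le; exact: le_trans (TNX N) (r1 N).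
suff -> : spectrum (T + X : bop H) = [set z : R[i]^o | rnorm (z : R[i]) <= 1].
  exact: unit_disc_connected.
apply/seteqP; split=> z.
  move=> /spectrumE Tz; rewrite /mkset leNgt; apply/negP => z1; apply: Tz.
  by apply: binv_large; exact: le_lt_trans z1.
move=> z1; apply/spectrumE => -[S [ST _]].
have S0 := bnorm_ge0 S.
(* Twice this tolerance times [|S|] is below 1, which the approximate eigenvector [x] in the range
   of [E N] will contradict. *)
have e0 : 0 < (2 * (bnorm S + 1))^-1 by rewrite invr_gt0; lra.
have [N0 N0P] := half_exp_small e0.
have [N NN lz] := disc_point_dense N0 z1 e0.
have cN : c N < (2 * (bnorm S + 1))^-1.
  by apply: N0P; apply: (leq_trans NN); rewrite -addn3 leq_addr.
have [_ [_ E2] E0 _] := EP N.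
have [y Ey0] : exists y, E N y <> 0.
  by apply: contrapT => /forallNP h; apply: E0; apply: bopP => y; apply: contrapT => /(h _).
have Ey_gt0 := rnorm_gt0 Ey0; set x := E N y in Ey0 Ey_gt0.
have TXx : (T + X - z *: one) x = (disc_point R N - z) *: x + (X * E N) x.
  rewrite /x !(bopDE, bopNE) -[T _]bopME TE bopZE -bopME bopZE bop1E.
  by rewrite bopME -!bopME -mulrA E2 addrAC -scalerBl.
have xE : S ((T + X - z *: one) x) = x by rewrite -bopME ST.
have : rnorm x <= bnorm S * ((2 * (bnorm S + 1))^-1 * rnorm x + (2 * (bnorm S + 1))^-1 * rnorm x).
  rewrite -{1}xE; apply: (le_trans (rnorm_bop _ _)); rewrite ler_wpM2l// TXx.
  apply: (le_trans (rnormD _ _)); apply: lerD.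
    by rewrite rnormZ ler_wpM2r ?rnorm_ge0 ?ltW.
  by apply: rnorm_bop_le; apply: le_trans (XE N) _; exact: ltW.
rewrite -mulrDl mulrA.
have -> : bnorm S * ((2 * (bnorm S + 1))^-1 + (2 * (bnorm S + 1))^-1) = bnorm S / (bnorm S + 1).
  by field; rewrite gt_eqF//; lra.
have : bnorm S / (bnorm S + 1) < 1 by rewrite ltr_pdivrMr; lra.
nra.
Qed.

End ConnectedSpectrum.

(** * Comparison with the order on projections *)

Section Projections.
Variables (R : realType) (H : hilbertSpace R).
Implicit Types (P E : bop H).

Lemma projection_bproj P : projection P <-> bproj P.
Proof.
split=> -[PP P2]; split.
- exact: adjoint_radj.
- by apply: bopP => x; rewrite bopME -[RHS](congr1 (fun f : H -> H => f x) P2).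
- by apply: radj_adjoint => //; exact: bop_linear.
- by apply: funext => x; rewrite -[LHS]/((P * P) x) P2.
Qed.

(** If [E <= P] and [P y = 0], then [<(P - E) y, y> = - |E y|^2] forces [E y = 0]; this gives
    [E (1 - P) = 0]. Conversely, [P - E] is itself a projection, hence nonnegative. *)
Lemma op_leP E P : bproj E -> bproj P -> op_le E P <-> P * E = E.
Proof.
move=> pE pP; have [[EE E2] [PP P2]] := (pE, pP); split=> [EP|PE].
  apply: bproj_leC => //; apply/eqP; rewrite eq_sym -subr_eq0; apply/eqP.
  have -> : E - E * P = E * (1 - P) by rewrite mulrBr mulr1.
  apply: bopP => x; apply: rnorm_eq0; apply/eqP; rewrite -sqrf_eq0 -ripxx bopME.
  set y := (1 - P) x; rewrite eq_le ripxx sqr_ge0 andbT -ripxx EE -bopME E2 ripC.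
  have Py : P y = 0 by rewrite /y -bopME mulrBr mulr1 P2 subrr.
  have : 0 <= rip ((P - E) y) y by have := EP y; rewrite lecE => /andP[].
  by rewrite bopDE bopNE Py add0r ripNl oppr_ge0.
have EP : E * P = E.
  by apply: (@radj_uniq _ _ E) => //; rewrite -{1}PE; exact: radjM.
have D2 : (P - E) * (P - E) = P - E.
  by rewrite mulrBl !mulrBr P2 PE EP E2 subrr subr0.
have DD : adjoint_of (P - E : bop H) (P - E : bop H).
  by apply: radj_adjoint; [exact: bop_linear | exact: radjB].
move=> x; rewrite -[(_ - _) x]/((P - E : bop H) x) -D2 bopME DD -inner_normE.
by rewrite exprn_ge0.
Qed.

End Projections.

(** * The equivalence, for operators as bare functions *)

Theorem theorem1p1 (R : realType) (H : hilbertSpace R) (M I : set (H -> H))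
    (Phi : (H -> H) -> R)
    (hM : von_neumann_algebra M) (hdim : dim_gt1 M)
    (hI : ideal M I) (hdense : wot_dense M I)
    (hPhi : norm_on I Phi) (hinv : unitarily_invariant M I Phi)
    (hdom : norm_dominating I Phi) :
  (ereal_sup [set ereal_inf [set (Phi E)%:E | E in
                   [set E | [/\ (I `&` projections M) E, E <> 0%R & op_le E P]]]
             | P in [set P | projections M P /\ P <> 0%R]] < +oo)%E
  <->
  (forall (T : H -> H) (eps : R), M T -> 0 < eps ->
     exists X : H -> H, [/\ I X, Phi X < eps & ~ connected (spectrum (T + X))]).
Proof.
have bop_neq0 (P : bop H) : P <> 0 -> bopf P <> 0.
  by move=> P0 PE; apply: P0; apply: bopP => x; rewrite PE.
set F := fun P : H -> H => [set (Phi E)%:E | E in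
  [set E | [/\ (I `&` projections M) E, E <> 0%R & op_le E P]]].
split=> [supF T0 eps MT0 eps0|dis].
  (* A positive real strictly above the supremum, so that each infimum is beaten by some [E]. For
     the value -oo the choice is 1. *)
  have [C [C0 supC]] : exists C : R, 0 < C /\ (ereal_sup [set ereal_inf (F P) |
      P in [set P | projections M P /\ P <> 0%R]] < C%:E)%E.
    move: supF; case: (ereal_sup _) => [r _|//|_]; last by exists 1; rewrite ltNyr.
    by exists (`|r| + 1); rewrite lte_fin; have := ler_norm r; have := normr_ge0 r; lra.
  have [T MT <-] := inM_bop hM MT0.
  have [|X [IX Xeps nX]] := small_disconnecting_perturbation hM hdim hI hPhi hinv C0 _ MT eps0.
    move=> P MP PP P2 P0.
    have /ereal_inf_lt[_ [E0 [[IE [ME pE]] E00 EP] <-]] : (ereal_inf (F P) < C%:E)%E.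
      apply: le_lt_trans supC; apply: ereal_sup_ubound; exists P => //; split.
        by split=> //; apply/projection_bproj.
      exact: bop_neq0.
    have [E ME' EE] := inM_bop hM ME; rewrite -EE in IE pE E00 EP *.
    rewrite lte_fin => EC; move/projection_bproj: pE => pE.
    exists E; split; last by case: pE.
    split=> //; [by case: pE | by move=> E0'; apply: E00; rewrite E0' | | exact: ltW].
    by apply/op_leP.
  by exists X.
rewrite ltNge leye_eq; apply/negP => /eqP supF.
(* An infinite supremum supplies, for every [n], a nonzero projection whose infimum exceeds [n]. *)
have [n|T MT Tc] := stable_connected_spectrum hM hI hdense hPhi hinv hdom.
  have : (n%:E < ereal_sup [set ereal_inf (F P) |
      P in [set P | projections M P /\ P <> 0%R]])%E by rewrite supF ltry.
  move=> /ereal_sup_gt[_ [P0 [[MP pP] P00] <-] nP].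
  have [P MP' PE] := inM_bop hM MP; rewrite -PE in pP P00 nP.
  move/projection_bproj: pP => pP; exists P; split=> //.
    by move=> P0'; apply: P00; rewrite P0'.
  move=> E IE pE E0 EP; rewrite -lee_fin; apply: le_trans (ltW nP) _.
  apply: ereal_inf_lbound; exists (E : H -> H) => //; split.
  - by split=> //; split; [exact: (ideal_sub hI) | apply/projection_bproj].
  - exact: bop_neq0.
  - by apply/op_leP.
(* Statement (2) at this [T] with tolerance 1/2 contradicts the stability of its connected
   spectrum. *)
have [X0 [IX0 X0e nX]] := dis T 2^-1 MT ltac:(by rewrite invr_gt0).
have [X MX XE] := inM_bop hM (ideal_sub hI IX0); rewrite -XE in IX0 X0e nX.
by apply: nX; apply: Tc.
Qed.
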